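(* Let $\alpha>0$ be fixed and let $p=p(n)$ satisfy $p=\omega(n^{-2/3})$, i.e. $p(n)\,n^{2/3}\to\infty$. For each $n$ let $G_\alpha=G_\alpha(n)$ be any $n$-vertex graph on vertex set $[n]$ with minimum degree $\delta(G_\alpha)\ge \alpha n$. Then asymptotically almost surely (i.e. with probability tending to $1$ as $n\to\infty$) the graph $G_\alpha\cup G(n,p)$ is $\mathcal{F}(n,2)$-universal.
   Context: $G(n,p)$ denotes the binomial random graph on vertex set $[n]$ in which each pair of vertices is an edge independently with probability $p$; $G_\alpha\cup G(n,p)$ is the graph on $[n]$ whose edge set is the union of the two edge sets. $\mathcal{F}(n,2)$ is the family of all $n$-vertex graphs with maximum degree at most $2$. A graph $G$ is $\mathcal{F}$-universal if it contains every $F\in\mathcal{F}$ as a (not necessarily induced) subgraph. *)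

(* Defs.v *)
From HB Require Import structures.
From mathcomp Require Import all_boot all_order all_algebra.

Set Implicit Arguments.
Unset Strict Implicit.
Unset Printing Implicit Defensive.

Import GRing.Theory.

Local Open Scope ring_scope.

(* A finite simple graph on V is given by its edge set, a set of 2-subsets *)
(* of V; this makes the graphs on V a finType.                             *)
Record sgraph (V : finType) := SGraph {
  edges : {set {set V}};
  edgesP : [forall e in edges, #|e| == 2%N]
}.

HB.instance Definition _ (V : finType) := [isSub for @edges V].
HB.instance Definition _ (V : finType) := [Equality of sgraph V by <:].
HB.instance Definition _ (V : finType) := [Choice of sgraph V by <:].
HB.instance Definition _ (V : finType) := [Countable of sgraph V by <:].
HB.instance Definition _ (V : finType) := [Finite of sgraph V by <:].

Section Graphs.
Variable V : finType.
Implicit Types G H : sgraph V.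

(* Irreflexive, since [set u; u] is not a 2-subset. *)
Definition adj G (u v : V) : bool := [set u; v] \in edges G.

Definition degree G (v : V) : nat := #|[set u | adj G v u]|.

Definition max_degree G : nat := (\max_(v : V) degree G v)%N.

(* All degrees are smaller than #|V|, so the default value #|V| only *)
(* matters when V is empty.                                          *)
Definition min_degree G : nat := \big[minn/#|V|]_(v : V) degree G v.

Lemma gunion_subproof G H :
  [forall e in edges G :|: edges H, #|e| == 2%N].
Proof.
apply/forall_inP => e; rewrite inE.
by case/orP; apply/forall_inP: e; exact: edgesP.
Qed.

Definition gunion G H : sgraph V := SGraph (gunion_subproof G H).

End Graphs.

(* F is isomorphic to a (not necessarily induced) subgraph of G. *)
Definition contains_copy (V W : finType) (G : sgraph V) (F : sgraph W) : bool :=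
  [exists f : {ffun W -> V},
     injectiveb f && [forall u, forall v, adj F u v ==> adj G (f u) (f v)]].

(* Graphs on n vertices are represented, up to isomorphism, on 'I_n. *)
Definition bounded_degree_graphs (n Delta : nat) : {set sgraph 'I_n} :=
  [set F | (max_degree F <= Delta)%N].

Definition universal (V W : finType) (Fam : {set sgraph W}) (G : sgraph V) :
  bool := [forall F in Fam, contains_copy G F].

Section BinomialRandomGraph.
Variables (R : pzRingType) (n : nat).

(* The probability that G(n,p) equals H: each of the 'C(n, 2) pairs is *)
(* independently an edge with probability p.                           *)
Definition gnp_mass (p : R) (H : sgraph 'I_n) : R :=
  \prod_(e : {set 'I_n} | #|e| == 2%N)
    (if e \in edges H then p else 1 - p).

Definition gnp_prob (p : R) (A : pred (sgraph 'I_n)) : R :=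
  \sum_(H : sgraph 'I_n | A H) gnp_mass p H.

End BinomialRandomGraph.

(* Main.v *)
Require Import Defs.
From HB Require Import structures.
From mathcomp Require Import all_boot all_order all_algebra all_fingroup.
From mathcomp Require Import ring lra zify.
From mathcomp Require Import boolp.

Set Implicit Arguments.
Unset Strict Implicit.
Unset Printing Implicit Defensive.

(* Work with $H = G(n,q)$, $q = C n^{-2/3}$ for a large constant $C(\alpha)$.
   Exponentially reliably, any two disjoint linear-sized sets are joined by an
   edge of $H$, and every linear-sized set contains cycles of all bounded
   lengths (Janson's inequality, applied to the closing of disjoint paths).

   A graph $F$ of maximum degree 2 lies in a union of disjoint cycles. Removing
   a small linear number of pairs of adjacent vertices from these cycles leaves
   pieces of bounded size, which are embedded greedily in $H$. Up to order there
   are only polynomially many shapes of pieces, and $H$ may be relabelled by a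
   random permutation, so for every shape there is an embedding such that for
   all $u, v$ there are linearly many embedded consecutive vertices $a, c, b$
   with $a, b$ adjacent to $v$ and $c$ adjacent to $u$ in $G_\alpha$. A left-over
   vertex $v$, to be used for a removed vertex whose outer neighbour sits at $u$,
   can then replace such a $c$, and $c$ serves instead; the two vertices $c, c'$
   used for a removed pair can be chosen adjacent in $H$. *)

(** * Sequences, paths and greedy packings *)

(** Expansion and short cycles are needed in all linear-sized sets at once, so every failure
    probability must beat $2^n$; this fixes the scale of $q$. A cycle inside a set $U$ is sought in
    a special form: a path in $U$, supplied by expansion alone, closed by three random edges through
    two reserved sets. With linearly many disjoint paths there are about $n^3$ ways to close one, so
    Janson's exponent is of order $n^3 q^3$ whatever the length of the cycle, and this is linear in
    $n$ when $q$ is of order $n^{-2/3}$.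

    The number of removed pairs is under two opposite demands. Their vertices are the slack that
    keeps the greedy embedding from running out of room, so they must be linearly many; and they
    must be few compared with the triples available for absorption.

    The embedding of the pieces is found without looking at $G_\alpha$, about which only the degrees
    are known. The random relabelling makes up for this: it spreads one fixed embedding evenly over
    the neighbourhoods of $G_\alpha$. *)

Lemma subset_of_card (T : finType) (A : {set T}) k :
  k <= #|A| -> exists2 B : {set T}, B \subset A & #|B| = k.
Proof.
rewrite cardE => kA; exists [set x in take k (enum A)].
  by apply/subsetP => x; rewrite inE => /mem_take; rewrite mem_enum.
by rewrite cardsE (card_uniqP _) ?take_uniq ?enum_uniq // size_takel.
Qed.

Section Joined.
Variables (V : finType) (e : rel V).

Definition joined (s : nat) : Prop := forall X Y : {set V},
  [disjoint X & Y] -> s <= #|X| -> s <= #|Y| ->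
  exists x y, [/\ x \in X, y \in Y & e x y].

(* [path.cycle e [:: x]] would require a loop at [x]. *)
Definition cyclic (c : seq V) : bool := (size c <= 1) || path.cycle e c.

(** Induction on the number of edges, keeping [s] possible starting points so that [joined] can be
    used again. Of [2 * s] fresh vertices, fewer than [s] can miss all the starting points found in
    the rest of [U]. *)
Lemma joined_paths s : joined s -> forall k (U : {set V}), k.+1 * (2 * s) <= #|U| ->
  exists2 T : {set V}, s <= #|T| & forall x, x \in T ->
    exists c, [/\ size c = k, uniq (x :: c), path e x c & {subset x :: c <= U}].
Proof.
move=> je; elim=> [|k IH] U Us.
  exists U => [|x xU]; first lia.
  by exists [::]; split=> // y; rewrite inE => /eqP ->.
have [U2 U2U U2s] : exists2 B : {set V}, B \subset U & #|B| = 2 * s.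
  by apply: subset_of_card; lia.
have [T' T's T'P] : exists2 T : {set V}, s <= #|T| & forall x, x \in T ->
    exists c, [/\ size c = k, uniq (x :: c), path e x c & {subset x :: c <= U :\: U2}].
  by apply: IH; rewrite cardsD (setIidPr U2U) U2s; lia.
pose T := [set x in U2 | [exists y, (y \in T') && e x y]].
exists T; last first.
  move=> x; rewrite inE => /andP[xU2 /existsP[y /andP[yT exy]]].
  have [c [cs uc pc cU]] := T'P y yT.
  exists (y :: c); split; [by rewrite /= cs| |by rewrite /= exy|].
    by apply/andP; split=> //; apply/negP => /cU; rewrite inE xU2.
  move=> z; rewrite inE => /orP[/eqP ->|/cU]; first exact: (subsetP U2U).
  by rewrite inE => /andP[].
rewrite leqNgt; apply/negP => Ts.
have TU2 : T \subset U2 by apply/subsetP => x; rewrite inE => /andP[].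
have [||x [y [+ yT exy]]] := je (U2 :\: T) T' _ _ T's.
- rewrite -setI_eq0; apply/eqP/setP => z; rewrite !inE; apply/negP.
  case/andP => /andP[_ zU2] /T'P[c [_ _ _ /(_ z)]].
  by rewrite mem_head inE zU2 => /(_ isT).
- by rewrite cardsD (setIidPr TU2) U2s; lia.
rewrite !inE => /andP[+ xU2]; rewrite xU2 /=.
by move/existsP; apply; exists y; rewrite yT.
Qed.

Lemma joined_path s k (U : {set V}) : 0 < s -> joined s -> k.+1 * (2 * s) <= #|U| ->
  exists c, [/\ size c = k.+1, uniq c, sorted e c & {subset c <= U}].
Proof.
move=> s0 je /(joined_paths je)[T Ts TP].
have [T0|[x /TP[c [cs uc pc cU]]]] := set_0Vmem T.
  by move: Ts; rewrite T0 cards0; lia.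
by exists (x :: c); split=> //=; rewrite cs.
Qed.

(** The other pieces occupy at most [sumn sh] vertices, so the slack [w] always leaves room for the
    next one. *)
Lemma greedy_packing (P : pred (seq V)) (w : nat) (sh : seq nat) :
  (forall l (U : {set V}), l \in sh -> w <= #|U| ->
     exists c, [/\ size c = l, uniq c, P c & {subset c <= U}]) ->
  forall U : {set V}, sumn sh + w <= #|U| ->
  exists cs, [/\ map size cs = sh, uniq (flatten cs), all P cs
               & {subset flatten cs <= U}].
Proof.
elim: sh => [|l sh IH] Pex U Us; first by exists [::].
have [||cs [cs1 cs2 cs3 cs4]] := IH _ U; first by move=> k W ks; apply: Pex; rewrite inE ks orbT.
  by move: Us => /=; lia.
have [||c [c1 c2 c3 c4]] := Pex l (U :\: [set x in flatten cs]).
- exact: mem_head.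
- have : #|[set x in flatten cs]| = sumn sh.
    by rewrite cardsE (card_uniqP cs2) size_flatten /shape cs1.
  have := subset_leq_card (subsetIr U [set x in flatten cs]).
  by rewrite cardsD; move: Us => /=; lia.
exists (c :: cs); split => /=.
- by rewrite c1 cs1.
- rewrite cat_uniq c2 cs2 andbT /=; apply/hasPn => x xcs; apply/negP => /c4.
  by rewrite !inE xcs.
- by rewrite c3.
- by move=> x; rewrite mem_cat => /orP[/c4|/cs4 //]; rewrite inE => /andP[].
Qed.

End Joined.

(** * Graphs of maximum degree two as unions of cycles *)

Section Links.
Variable V : eqType.
Implicit Types (s c : seq V) (u v : V).

Definition plink s u v : Prop := exists s1 s2, s = s1 ++ [:: u, v & s2].
Definition clink c u v : Prop := u \in c /\ next c u = v.
Definition is_head u s : Prop := exists s', s = u :: s'.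
Definition is_last u s : Prop := exists s', s = rcons s' u.

Lemma plink_cat s1 s2 u v : plink (s1 ++ s2) u v ->
  [\/ plink s1 u v, is_last u s1 /\ is_head v s2 | plink s2 u v].
Proof.
elim: s1 => [|x s1 IH] /= [p [q]]; first by constructor 3; exists p, q.
case: p => [[-> Es]|y p [_ Es]].
  case: s1 Es {IH} => [/= ->|w s1 /= [-> _]].
    by constructor 2; split; [exists [::]|exists q].
  by constructor 1; exists [::], s1.
case: IH => [|[a [b ->]]|[[a ->] h]|h]; first by exists p, q.
- by constructor 1; exists (x :: a), b.
- by constructor 2; split=> //; exists (x :: a).
- by constructor 3.
Qed.

Lemma plink_clink c u v : uniq c -> plink c u v -> clink c u v.
Proof.
move=> uc [s1 [s2 Ec]]; split; first by rewrite Ec mem_cat mem_head orbT.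
by rewrite -(next_rot (size s1) uc) Ec rot_size_cat /= eqxx.
Qed.

Lemma clinkE c u v : uniq c -> clink c u v ->
  plink c u v \/ is_last u c /\ is_head v c.
Proof.
move=> uc [uinc <-]; have [s1 [s2 Ec]] : exists s1 s2, c = s1 ++ u :: s2.
  by case/splitPr: uinc => s1 s2; exists s1, s2.
rewrite -(next_rot (size s1) uc) Ec rot_size_cat.
case: s2 Ec => [|w s2] Ec; last by left; exists s1, s2; rewrite /= eqxx.
right; split; first by exists s1; rewrite -cats1.
by case: s1 Ec => [|w s1] Ec; rewrite /= eqxx; [exists [::]|exists (s1 ++ [:: u])].
Qed.

Lemma plink_nth x0 c i : i.+1 < size c -> plink c (nth x0 c i) (nth x0 c i.+1).
Proof.
move=> ic; exists (take i c), (drop i.+2 c).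
by rewrite -drop_nth // -drop_nth ?cat_take_drop // ltnW.
Qed.

Lemma clink_last x0 c : uniq c -> 0 < size c ->
  clink c (nth x0 c (size c).-1) (nth x0 c 0).
Proof.
move=> uc; case: (lastP c) uc => // s x uc _.
rewrite size_rcons nth_rcons ltnn eqxx; split; first by rewrite mem_rcons mem_head.
rewrite -(next_rot (size s) uc) -cats1 rot_size_cat.
by case: s {uc} => [|y s] /=; rewrite eqxx.
Qed.

Lemma plink_flatten (cs : seq (seq V)) c u v :
  c \in cs -> plink c u v -> plink (flatten cs) u v.
Proof.
move=> /splitPr[cs1 cs2] [a [b ->]].
exists (flatten cs1 ++ a), (b ++ flatten cs2).
by rewrite flatten_cat /= -!catA.
Qed.

End Links.

Section CycleCover.
Variables (V : finType) (e : rel V).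
Hypotheses (e_sym : symmetric e) (e_irr : irreflexive e).
Hypothesis deg2 : forall u, #|[set v | e u v]| <= 2.

Definition bilink (c : seq V) u v : Prop := clink c u v \/ clink c v u.

Lemma bilinkC c u v : bilink c u v -> bilink c v u.
Proof. by case; [right|left]. Qed.

(* The component of the graph is spanned by a longest path, whose interior
   vertices already have both their neighbours on it. *)
Lemma component_cycle (U : {set V}) x : x \in U ->
  (forall u v, u \in U -> e u v -> v \in U) ->
  exists c, [/\ uniq c, 0 < size c, {subset c <= U}
   & forall u v, u \in c -> e u v -> v \in c /\ bilink c u v].
Proof.
move=> xU Ucl.
pose P k := [exists t : k.-tuple V, [&& uniq t, sorted e t & all (mem U) t]].
have P1 : P 1 by apply/existsP; exists [tuple x]; rewrite /= xU.
have exP : exists k, P k by exists 1.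
have Pb k : P k -> k <= #|V|.
  by move=> /existsP[t /andP[ut _]]; rewrite -(size_tuple t) -(card_uniqP ut) max_card.
case: (ex_maxnP exP Pb) => k /existsP[t /and3P[uc sc cU]] kmax.
have size_max c : uniq c -> sorted e c -> all (mem U) c -> size c <= k.
  by move=> uc' sc' cU'; apply: kmax; apply/existsP; exists (in_tuple c); rewrite uc' sc'.
have k1 : 0 < k by exact: kmax.
move: (size_tuple t) uc sc cU; move: (tval t) => c ck uc sc /allP cU {t P P1 exP Pb kmax}.
have step i : i.+1 < size c -> e (nth x c i) (nth x c i.+1) by move/(sortedP x): sc; apply.
(* An interior vertex already has two neighbours on the path; a third one would violate [deg2]. *)
have inter i v : i.+2 < size c -> e (nth x c i.+1) v ->
    v = nth x c i \/ v = nth x c i.+2.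
  move=> ic ev; have [->|n1] := eqVneq v (nth x c i); first by left.
  have [->|n2] := eqVneq v (nth x c i.+2); first by right.
  have := deg2 (nth x c i.+1); rewrite leqNgt => /negP[].
  rewrite (_ : 2 = (size [:: v; nth x c i; nth x c i.+2]).-1) //=.
  have u3 : uniq [:: v; nth x c i; nth x c i.+2].
    rewrite /= !inE negb_or n1 n2 andbT /= nth_uniq //; last exact: ltnW (ltnW ic).
    by apply/eqP; lia.
  rewrite -[3](card_uniqP u3); apply: subset_leq_card; apply/subsetP => w.
  by rewrite !inE => /or3P[] /eqP -> //; [rewrite e_sym|]; apply: step; lia.
(* By maximality, an end of the path has no neighbour off the path. *)
have cc i v : i < size c -> e (nth x c i) v -> i = 0 \/ i = k.-1 -> v \in c.
  move=> ic ev ik; apply/negPn/negP => vc.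
  have vU : v \in U by apply: Ucl ev; apply: cU; exact: mem_nth.
  case: ik => ik; last first.
    have : size (rcons c v) <= k; last by rewrite size_rcons ck ltnn.
    apply: size_max; rewrite ?rcons_uniq ?vc //; last first.
      by apply/allP => w; rewrite mem_rcons inE => /orP[/eqP ->|/cU].
    move: ev sc; rewrite ik -ck nth_last; case: (c) ic => //= y c' _ ev sc.
    by rewrite rcons_path sc.
  have : size (v :: c) <= k; last by rewrite /= ck ltnn.
  apply: size_max => /=; rewrite ?vc //; last first.
    by apply/andP; split; [exact: vU|apply/allP].
  by move: ev sc ic; rewrite ik e_sym; case: (c) => [|y c'] //= ev sc _; rewrite ev.
exists c; split=> //; first by rewrite ck.
suff H u v : u \in c -> e u v -> v \in c -> bilink c u v.
  move=> u v uinc euv; suff vc : v \in c by split=> //; exact: H.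
  have := uinc; rewrite -index_mem => iu; have iuE := nth_index x uinc.
  have [i0|i0] := eqVneq (index u c) 0.
    by apply: (cc _ v iu); [rewrite iuE|left].
  have [ik|ik] := eqVneq (index u c) k.-1.
    by apply: (cc _ v iu); [rewrite iuE|right].
  have ic : (index u c).-1.+2 < size c by rewrite ck in iu *; lia.
  have [|->|->] := @inter (index u c).-1 v ic.
  - by rewrite prednK ?lt0n // iuE.
  - exact: mem_nth (ltnW (ltnW ic)).
  - exact: mem_nth ic.
have ninj i j : i < size c -> j < size c -> nth x c i = nth x c j -> i = j.
  by move=> ic jc /eqP; rewrite nth_uniq // => /eqP.
(* A chord cannot meet an interior vertex, so it joins the two ends and is the pair that closes the
   cycle. *)
have K i j : i < size c -> j < size c -> i < j -> e (nth x c i) (nth x c j) ->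
    bilink c (nth x c i) (nth x c j).
  move=> ic jc ij eij; have [E|nij] := eqVneq j i.+1.
    by rewrite E in jc *; left; apply: plink_clink => //; exact: plink_nth.
  have [jk|jk] := eqVneq j k.-1.
    have [->|i0] := eqVneq i 0; last first.
      have i2 : i.-1.+2 < size c by lia.
      have [|E|E] := @inter i.-1 (nth x c j) i2; first by rewrite prednK ?lt0n.
      - by have := ninj j i.-1 jc (ltnW (ltnW i2)) E; lia.
      - by have := ninj j i.-1.+2 jc i2 E; lia.
    by right; rewrite jk -ck; apply: clink_last => //; rewrite ck.
  have j2 : j.-1.+2 < size c by lia.
  have [|E|E] := @inter j.-1 (nth x c i) j2; first by rewrite prednK 1?e_sym //; lia.
  - by have := ninj i j.-1 ic (ltnW (ltnW j2)) E; lia.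
  - by have := ninj i j.-1.+2 ic j2 E; lia.
move=> uinc euv vinc.
have iu := nth_index x uinc; have iv := nth_index x vinc.
rewrite -iu -iv; rewrite -iu -iv in euv; move: uinc vinc; rewrite -!index_mem.
case: (ltngtP (index u c) (index v c)) => [ij|ij|ij] *; first exact: K.
- by apply/bilinkC/K; rewrite // e_sym.
- by rewrite ij e_irr in euv.
Qed.

(** Components are split off one at a time. A component that is a path is treated as a cycle too:
    its closing pair need not be an edge, since only edges have to be covered. *)
Lemma cycle_cover_in n (U : {set V}) : #|U| <= n ->
  (forall u v, u \in U -> e u v -> v \in U) ->
  exists cs, [/\ uniq (flatten cs), flatten cs =i U
   & forall u v, u \in U -> e u v -> exists2 c, c \in cs & bilink c u v].
Proof.
elim: n U => [|n IH] U Un Ucl.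
  have -> : U = set0 by apply/eqP; rewrite -cards_eq0; lia.
  by exists [::]; split=> // [x|u v]; rewrite inE.
have [->|[x xU]] := set_0Vmem U.
  by exists [::]; split=> // [y|u v]; rewrite inE.
have [c [uc c0 cU cl]] := component_cycle xU Ucl.
have cU' : [set y in c] \subset U by apply/subsetP => y; rewrite inE => /cU.
have [||cs [u1 u2 u3]] := IH (U :\: [set y in c]).
- have Ec : #|[set y in c]| = size c by rewrite cardsE (card_uniqP uc).
  by rewrite cardsD (setIidPr cU') Ec; lia.
- move=> u v; rewrite !inE => /andP[uc' uU] euv; rewrite (Ucl _ _ uU euv) andbT.
  by apply: contra uc' => vc; have [|] := cl v u vc; rewrite // e_sym.
exists (c :: cs); split=> [|y|u v uU euv] /=.
- rewrite cat_uniq uc u1 andbT /=; apply/hasPn => y; rewrite u2 !inE.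
  by case/andP.
- rewrite mem_cat u2 !inE; case yc: (y \in c) => //=; by rewrite (cU y yc).
- case uinc: (u \in c).
    by exists c; [exact: mem_head|case: (cl u v uinc euv)].
  have [|d dcs dl] := u3 u v _ euv; first by rewrite !inE uinc.
  by exists d => //; rewrite inE dcs orbT.
Qed.

(** On at most two vertices the closing pair is the consecutive pair reversed, so nothing is lost
    when such sequences are concatenated. *)
Lemma short_clink (c : seq V) u v : uniq c -> size c <= 2 -> u != v ->
  clink c u v -> plink c u v \/ plink c v u.
Proof.
move=> uc c2 uv /(clinkE uc)[|[]]; first by left.
move=> [s Es] [s' Es']; right; exists [::], [::] => /=.
move: c2 Es' uv; rewrite {}Es; case: s {uc} => [|a [|b s]] //=.
- by move=> _ [->]; rewrite eqxx.
- by move=> _ [-> _].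
- by rewrite size_rcons.
Qed.

(** Isolated vertices and edges are strung together into one sequence [z], which joins the long
    cycles as soon as it has three vertices. Otherwise a matching, say, would give linearly many
    pieces too short to contain a triple for absorption. *)
Lemma cycle_cover : exists cs z,
  [/\ perm_eq (z ++ flatten cs) (enum V), all (fun c => 2 < size c) cs, size z <= 2
   & forall u v, e u v -> exists2 c, c \in z :: cs & bilink c u v].
Proof.
have [] := @cycle_cover_in #|V| [set: V].
- by rewrite cardsT.
- by move=> u v; rewrite !inE.
move=> cs [u1 u2 u3].
pose z := flatten [seq c <- cs | size c <= 2].
pose cs' := [seq c <- cs | ~~ (size c <= 2)].
have zp : perm_eq (z ++ flatten cs') (enum V).
  apply: uniq_perm; rewrite ?enum_uniq //; last first.
    move=> y; rewrite mem_enum inE -flatten_cat.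
    have /perm_mem <- : perm_eq (flatten cs) (flatten ([seq c <- cs | size c <= 2] ++ cs')).
      by apply: perm_flatten; rewrite perm_sym; exact/permPl/perm_filterC.
    by rewrite u2 inE.
  rewrite -flatten_cat (perm_uniq (_ : perm_eq _ (flatten cs))) //.
  by apply: perm_flatten; exact/permPl/perm_filterC.
have uz : uniq z.
  by move: zp => /perm_uniq; rewrite enum_uniq cat_uniq => /andP[].
have cover u v : e u v -> exists2 c, c \in z :: cs' & bilink c u v.
  move=> euv; have [|c ccs cl] := u3 u v _ euv; first by rewrite inE.
  case c2: (size c <= 2); last first.
    by exists c => //; rewrite inE mem_filter c2 ccs orbT.
  exists z; first exact: mem_head.
  have cz : c \in [seq c <- cs | size c <= 2] by rewrite mem_filter c2.
  have uc : uniq c.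
    move: uz; rewrite /z; move: cz => /splitPr[a b]; rewrite flatten_cat /= !cat_uniq.
    by case/and3P => _ _ /andP[].
  have uv : u != v by apply: contraTneq euv => ->; rewrite e_irr.
  have H a b : plink c a b -> clink z a b.
    by move=> h; apply: plink_clink => //; exact: plink_flatten h.
  have vu : v != u by rewrite eq_sym.
  by case: cl => [/(short_clink uc c2 uv)|/(short_clink uc c2 vu)] [] /H; [left|right|right|left].
have cs'3 : all (fun c => 2 < size c) cs'.
  by apply/allP => c; rewrite mem_filter -ltnNge => /andP[].
case z2: (size z <= 2); first by exists cs', z.
exists (z :: cs'), [::]; split=> //=; first by rewrite cs'3 ltnNge z2.
by move=> u v /cover[c cz cl]; exists c => //; rewrite inE cz orbT.
Qed.

End CycleCover.

(** * Cutting cycles into short pieces *)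

Section Cutting.
Variable V : eqType.
Implicit Types (s c : seq V) (u v : V) (cs : seq (seq V)).

(* [((y, x), (x', y'))]: the adjacent vertices [x], [x'] are removed from a
   cycle; [y] precedes [x] and [y'] follows [x']. *)
Definition quad := ((V * V) * (V * V))%type.
Implicit Types (q : quad) (qs : seq quad).

Definition removed qs : seq V := flatten [seq [:: q.1.2; q.2.1] | q <- qs].

(** The pairs that the final embedding must respect. The closing pairs of cut pieces are included
    although the graph does not ask for them, because every piece is embedded as a whole cycle. *)
Definition link cs qs u v : Prop :=
  (exists2 c, c \in cs & clink c u v) \/
  (exists2 q, q \in qs & [\/ (u, v) = q.1, (u, v) = (q.1.2, q.2.1) | (u, v) = q.2]).

(** Centers of triples are never ends of pieces, so this keeps the outer neighbours of a removed
    pair in place during absorption. *)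
Definition quad_ends cs qs : Prop := forall q, q \in qs ->
  (exists2 c, c \in cs & is_last q.1.1 c) /\ (exists2 c, c \in cs & is_head q.2.2 c).

Lemma removed_cat qs1 qs2 : removed (qs1 ++ qs2) = removed qs1 ++ removed qs2.
Proof. by rewrite /removed map_cat flatten_cat. Qed.

Lemma link_catl cs1 qs1 cs2 qs2 u v :
  link cs1 qs1 u v -> link (cs1 ++ cs2) (qs1 ++ qs2) u v.
Proof.
by case=> [[c cc]|[q qq]]; [left; exists c|right; exists q]; rewrite ?mem_cat ?cc ?qq.
Qed.

Lemma link_catr cs1 qs1 cs2 qs2 u v :
  link cs2 qs2 u v -> link (cs1 ++ cs2) (qs1 ++ qs2) u v.
Proof.
by case=> [[c cc]|[q qq]]; [left; exists c|right; exists q]; rewrite ?mem_cat ?cc ?qq ?orbT.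
Qed.

Lemma quad_ends_cat cs1 qs1 cs2 qs2 : quad_ends cs1 qs1 -> quad_ends cs2 qs2 ->
  quad_ends (cs1 ++ cs2) (qs1 ++ qs2).
Proof.
move=> e1 e2 q; rewrite mem_cat => /orP[/e1|/e2] [[c cc h] [d dd k]].
  by split; [exists c|exists d]; rewrite ?mem_cat ?cc ?dd.
by split; [exists c|exists d]; rewrite ?mem_cat ?cc ?dd ?orbT.
Qed.

Lemma quad_ends_sub cs cs' qs : {subset cs <= cs'} -> quad_ends cs qs -> quad_ends cs' qs.
Proof. by move=> sub h q /h[[c /sub cc ?] [d /sub dd ?]]; split; [exists c|exists d]. Qed.

Lemma plink2 (x y u v : V) : plink [:: x; y] u v -> u = x /\ v = y.
Proof.
move=> [s1 [s2 E]]; have : size s1 = 0.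
  by move/(congr1 size): E; rewrite size_cat /=; lia.
by case: s1 E => //= -[-> ->].
Qed.

Lemma is_last2 (x y u : V) : is_last u [:: x; y] -> u = y.
Proof. by case=> s /(congr1 (last x)) /=; rewrite last_rcons. Qed.

Lemma perm_merge (T : eqType) (a b c d : seq T) :
  perm_eq ((a ++ b) ++ (c ++ d)) ((a ++ c) ++ (b ++ d)).
Proof. by rewrite -!catA perm_cat2l perm_catCA. Qed.

(** Chunks of [L - 3] vertices are cut off, each followed by a removed pair, so a pair accounts for
    [L.-1] vertices. This is done while more than [L] vertices remain, so the rest is never
    empty. *)
Lemma cut_path L s : 3 < L -> 0 < size s -> uniq s -> exists cs qs,
  [/\ perm_eq (flatten cs ++ removed qs) s,
      all (fun c => 0 < size c <= L) cs,
      forall u v, plink s u v -> link cs qs u v,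
      quad_ends cs qs
    & [/\ forall h, is_head h s -> exists2 c, c \in cs & is_head h c,
          forall h, is_last h s -> exists2 c, c \in cs & is_last h c,
          L.-1 * size qs <= size s, size s <= L * (size qs).+1
        & size cs = (size qs).+1]].
Proof.
move=> L3; have [n] := ubnP (size s); elim: n s => // n IH s sn s0 us.
case: (leqP (size s) L) => sL.
  exists [:: s], [::]; split=> /=.
  - by rewrite !cats0.
  - by rewrite s0 sL.
  - by move=> u v /plink_clink h; left; exists s; [rewrite mem_head|exact: h].
  - by [].
  - split=> //; [by move=> h hs; exists s; rewrite ?mem_head..|by lia|by lia].
have Es := cat_take_drop (L - 3) s.
have ts : size (take (L - 3) s) = L - 3 by rewrite size_takel //; lia.
have ds : size (drop (L - 3) s) = size s - (L - 3) by rewrite size_drop.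
move: (take _ s) (drop _ s) ts ds Es => ch [|x [|x' s']] ts ds Es; try by move: ds => /=; lia.
have {IH} := IH s'; have s's : (size s').+2 = size s - (L - 3) by rewrite -ds.
move=> []; first lia.
- lia.
- by move: us; rewrite -Es !cat_uniq => /and3P[_ _] /=; case/and3P.
move=> cs [qs [h1 h2 h3 h4 [h5 h6 h7 h8 h9]]].
case: (lastP ch) ts Es => [|ch' y] ts Es; first by move: ts => /=; lia.
case: s' s's ds Es h1 h3 h5 h6 h7 h8 => [|y' s'] s's ds Es h1 h3 h5 h6 h7 h8.
  by move: s's; rewrite [size _]/=; lia.
exists (rcons ch' y :: cs), (((y, x), (x', y')) :: qs).
have hd : is_head y' (y' :: s') by exists s'.
have sub : {subset cs <= rcons ch' y :: cs} by move=> c; rewrite inE orbC => ->.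
have lk q : q \in qs -> q \in ((y, x), (x', y')) :: qs by rewrite inE orbC => ->.
have Q : ((y, x), (x', y')) \in ((y, x), (x', y')) :: qs by rewrite mem_head.
split.
- rewrite -Es /= -catA perm_cat2l.
  rewrite -[x :: x' :: y' :: s']/([:: x; x'] ++ y' :: s').
  by rewrite -[removed _]/([:: x; x'] ++ removed qs) perm_catCA perm_cat2l.
- by apply/andP; split=> //; rewrite ts; lia.
- move=> u v; rewrite -Es -[x :: x' :: y' :: s']/([:: x; x'] ++ y' :: s').
  move=> /plink_cat[h|[[a /rcons_inj[_ <-]] [b [<- _]]]|].
  + left; exists (rcons ch' y); first exact: mem_head.
    apply: plink_clink => //; move: us; rewrite -Es cat_uniq.
    by case/andP.
  + by right; exists ((y, x), (x', y')) => //; constructor 1.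
  + move=> /plink_cat[/plink2[-> ->]|[/is_last2 -> [b [<- _]]]|/h3].
    * by right; exists ((y, x), (x', y')) => //; constructor 2.
    * by right; exists ((y, x), (x', y')) => //; constructor 3.
    * case=> [[c /sub cc cl]|[q /lk qq ql]]; first by left; exists c.
      by right; exists q.
- move=> q; rewrite inE => /orP[/eqP ->|/h4] /=.
    split; first by exists (rcons ch' y); [exact: mem_head|exists ch'].
    by have [c /sub cc cl] := h5 _ hd; exists c.
  by move=> [[c /sub cc cl] [d /sub dd dh]]; split; [exists c|exists d].
- split=> /=.
  + move=> h [a]; rewrite -Es => E; exists (rcons ch' y); first exact: mem_head.
    case: ch' {ts sub} Es E => [|z ch'] Es /= [<- _]; first by exists [::].
    by exists (rcons ch' y).
  + move=> h [a]; rewrite -Es -[x :: x' :: y' :: s']/([:: x; x'] ++ y' :: s') catA => E.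
    have [|c /sub cc cl] := h6 h; last by exists c.
    have El : h = last y' s' by have := congr1 (last x) E; rewrite last_cat last_rcons.
    by rewrite El; exists (belast y' s'); rewrite -lastI.
  + by move: h7 s's => /=; lia.
  + by move: h8 s's => /=; lia.
  + by rewrite h9.
Qed.

(** The first two vertices are removed and the remaining path is cut. The ends of that path are the
    outer neighbours of the first pair, whose two vertices account for [L.+2] in place of [L]. *)
Lemma cut_cycle L c : 3 < L -> 2 < size c -> uniq c -> exists cs qs,
  [/\ perm_eq (flatten cs ++ removed qs) c,
      all (fun c => 0 < size c <= L) cs,
      forall u v, clink c u v -> link cs qs u v,
      quad_ends cs qs
    & [/\ 0 < size qs, L.-1 * (size qs).-1 <= size c, size c <= L.+2 * size qs
        & size cs = size qs]].
Proof.
case: c => [|x [|x' s]] // L3 s2 uc.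
have us : uniq s by move: uc => /= /and3P[].
have s0 : 0 < size s by move: s2.
have [cs [qs [h1 h2 h3 h4 [h5 h6 h7 h8 h9]]]] := cut_path L3 s0 us.
case: s s0 {s2} uc us h1 h3 h5 h6 h7 h8 => // y' s _ uc us h1 h3 h5 h6 h7 h8.
pose q0 := ((last y' s, x), (x', y')); exists cs, (q0 :: qs).
have lk q : q \in qs -> q \in q0 :: qs by rewrite inE orbC => ->.
have Q : q0 \in q0 :: qs by rewrite mem_head.
split=> //.
- rewrite -[x :: x' :: y' :: s]/([:: x; x'] ++ y' :: s).
  by rewrite -[removed _]/([:: x; x'] ++ removed qs) perm_catCA perm_cat2l.
- move=> u v /(clinkE uc)[|[[a Ea] [b [<- _]]]]; last first.
    have -> : u = last y' s by have := congr1 (last x) Ea; rewrite last_rcons /= => <-.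
    by right; exists q0 => //; constructor 1.
  rewrite -[x :: x' :: y' :: s]/([:: x; x'] ++ y' :: s).
  move=> /plink_cat[/plink2[-> ->]|[/is_last2 -> [b [<- _]]]|/h3].
  + by right; exists q0 => //; constructor 2.
  + by right; exists q0 => //; constructor 3.
  + case=> [[c cc cl]|[q /lk qq ql]]; first by left; exists c.
    by right; exists q.
- move=> q; rewrite inE => /orP[/eqP ->|/h4 //] /=; split.
    by apply: h6; exists (belast y' s); rewrite -lastI.
  by apply: h5; exists s.
- by split=> //=; move: h7 h8 => /=; lia.
Qed.

(** Cycles with at most [L] vertices stay whole once the demand [r0] is met, which keeps the pairs
    few for a union of triangles, for instance. A cycle longer than [L] pays for its rounding term
    [L.-1] with its own vertices, whence the factor 2; a shorter cycle that is cut charges it to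
    [r0]. *)
Lemma cut_cycles L r0 cs0 : 3 < L -> uniq (flatten cs0) ->
  all (fun c => 2 < size c) cs0 -> exists cs qs,
  [/\ perm_eq (flatten cs ++ removed qs) (flatten cs0),
      all (fun c => 0 < size c <= L) cs,
      forall u v, (exists2 c, c \in cs0 & clink c u v) -> link cs qs u v,
      quad_ends cs qs
    & [/\ r0 <= size qs \/ size (flatten cs0) <= L.+2 * size qs,
          L.-1 * size qs <= 2 * size (flatten cs0) + L.-1 * r0
        & count (fun c => size c < 3) cs <= size qs]].
Proof.
move=> L3; elim: cs0 r0 => [|c cs0 IH] r0 /=.
  exists [::], [::]; split=> //; first by move=> u v [c].
  by split; [right|rewrite /= muln0|].
rewrite cat_uniq => /and3P[uc _ u0] /andP[c2 a0].
have [cs [qs [h1 h2 h3 h4 [h5 h6 h7]]]] := IH r0.-1 u0 a0.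
case: (boolP ((r0 == 0) && (size c <= L))) => [/andP[/eqP r00 cL]|r0c].
  exists (c :: cs), qs; split=> /=.
  - by rewrite -catA perm_cat2l.
  - by rewrite h2 cL andbT; lia.
  - move=> u v [d]; rewrite inE => /orP[/eqP ->|dc] dl.
      by left; exists c; rewrite ?mem_head.
    have [|[f ff fl]|] := h3 u v; first by exists d.
      by left; exists f; rewrite // inE ff orbT.
    by right.
  - by apply: quad_ends_sub h4 => d; rewrite inE orbC => ->.
  - by rewrite r00 size_cat; split; [left|move: h6; rewrite r00; lia|lia].
have [cs1 [qs1 [k1 k2 k3 k4 [k5 k6 k7 k8]]]] := cut_cycle L3 c2 uc.
exists (cs1 ++ cs), (qs1 ++ qs); split.
- rewrite flatten_cat removed_cat; apply: perm_trans (perm_merge _ _ _ _) _.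
  exact: perm_cat.
- by rewrite all_cat k2 h2.
- move=> u v [d]; rewrite inE => /orP[/eqP ->|dc] dl.
    by apply: link_catl; exact: k3.
  by apply: link_catr; apply: h3; exists d.
- exact: quad_ends_cat.
- rewrite !size_cat; split.
  + by case: h5 => h5; [left; lia|right; rewrite mulnDr leq_add].
  + have [b Eb] : exists b, size qs1 = b.+1 by exists (size qs1).-1; lia.
    move: k6 h6 r0c {h5}; rewrite Eb mulnDr mulnS negb_and -ltnNge.
    case: r0 => [|r0] /=; rewrite ?mulnS; lia.
  + rewrite count_cat leq_add //; apply: leq_trans (count_size _ _) _.
    by rewrite k8.
Qed.

End Cutting.

(** * Absorption *)

Lemma uniq_flatten_mem (T : eqType) (L : seq (seq T)) l : uniq (flatten L) -> l \in L -> uniq l.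
Proof.
move=> uL lL; move: uL; case/splitPr: lL => a b; rewrite flatten_cat cat_uniq /= cat_uniq.
by case/and3P => _ _ /andP[].
Qed.

Lemma uniq_flatten_inj (T : eqType) (L : seq (seq T)) l l' x :
  uniq (flatten L) -> l \in L -> l' \in L -> x \in l -> x \in l' -> l = l'.
Proof.
elim: L => //= k L IH; rewrite cat_uniq => /and3P[_ kL uL].
have N m : x \in k -> m \in L -> x \in m -> False.
  by move=> xk mL xm; move/hasP: kL; apply; exists x => //; apply/flattenP; exists m.
rewrite !inE => /orP[/eqP ->|lL] /orP[/eqP ->|l'L] // xl xl'; last exact: IH.
  by case: (N l').
by case: (N l).
Qed.

Section Triples.
Variable V : eqType.
Implicit Types (c : seq V) (t : V * V * V).

Fixpoint triples c : seq (V * V * V) :=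
  if c is [:: a, y, b & c'] then (a, y, b) :: triples c' else [::].

Definition center t : V := t.1.2.
Definition tseq t : seq V := [:: t.1.1; center t; t.2].

Lemma subseq_triples c : subseq (flatten (map tseq (triples c))) c.
Proof.
have [n] := ubnP (size c); elim: n c => // n IH [|a [|y [|b c]]] //= cn.
by rewrite !eqxx; apply: IH; lia.
Qed.

Lemma triplesP c t : t \in triples c -> exists s1 s2, c = s1 ++ tseq t ++ s2.
Proof.
have [n] := ubnP (size c); elim: n c => // n IH [|a [|y [|b c]]] //= cn.
rewrite inE => /orP[/eqP ->|]; first by exists [::], c.
by move/IH => [|s1 [s2 ->]]; [lia|exists [:: a, y, b & s1], s2].
Qed.

(** A sequence of [3 * k + r] vertices with [r <= 2] has [k] triples; the factor 5 is the worst case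
    [k = 1], [r = 2]. *)
Lemma size_triples c : size c <= 5 * size (triples c) + 2 * (size c < 3).
Proof.
have [n] := ubnP (size c); elim: n c => // n IH [|a [|y [|b c]]] //= cn.
by have := IH c; case: (size c < 3) => /=; lia.
Qed.

Lemma triples_clink c t : uniq c -> t \in triples c ->
  clink c t.1.1 (center t) /\ clink c (center t) t.2.
Proof.
move=> uc /triplesP[s1 [s2 Ec]]; split; apply: plink_clink => //.
  by exists s1, (t.2 :: s2).
by exists (rcons s1 t.1.1), s2; rewrite cat_rcons.
Qed.

Lemma triples_not_last c t : uniq c -> t \in triples c -> ~ is_last (center t) c.
Proof.
move=> uc /triplesP[s1 [s2 Ec]] [s Ec']; move: uc; rewrite Ec.
have: last (center t) c = center t by rewrite Ec' last_rcons.
rewrite Ec !last_cat /= => E; rewrite cat_uniq /= -E => /and3P[_ _ /and3P[_ + _]].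
by rewrite mem_last.
Qed.

Lemma triples_not_head c t : uniq c -> t \in triples c -> ~ is_head (center t) c.
Proof.
move=> uc /triplesP[s1 [s2 Ec]] [s Ec']; move: uc; rewrite Ec.
have: head (center t) c = center t by rewrite Ec'.
rewrite Ec; case: s1 {Ec} => [|z s1] /= E; rewrite E.
  by rewrite inE eqxx.
by rewrite mem_cat !inE eqxx !orbT.
Qed.

Lemma uniq_triples (cs : seq (seq V)) : uniq (flatten cs) ->
  uniq (flatten (map tseq (flatten (map triples cs)))).
Proof.
apply: subseq_uniq; elim: cs => //= c cs IH.
by rewrite map_cat flatten_cat cat_subseq // subseq_triples.
Qed.

(** The triples are disjoint. This ensures that exchanging centers never moves the two neighbours of
    a center. *)
Lemma center_nbr (T : seq (V * V * V)) t t' : uniq (flatten (map tseq T)) ->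
  t \in T -> t' \in T -> center t' <> t.1.1 /\ center t' <> t.2.
Proof.
move=> uT tT t'T.
have K z : z \in tseq t -> center t' = z -> z = center t.
  move=> zt E; have := uniq_flatten_inj uT (map_f tseq tT) (map_f tseq t'T) zt.
  by rewrite -E !inE eqxx orbT => /(_ isT) [_ -> _].
have /= := uniq_flatten_mem uT (map_f tseq tT).
rewrite !inE => /and3P[/norP[/eqP n1 _] /eqP n2 _].
split=> E; first by apply/n1/K => //; rewrite mem_head.
by apply: n2; apply/esym/K => //; rewrite !inE eqxx !orbT.
Qed.

End Triples.

Lemma swap_perm (V : finType) (xs ys : seq V) : size xs = size ys -> uniq (xs ++ ys) ->
  exists tau : {perm V}, (forall p, p \in zip xs ys -> tau p.1 = p.2 /\ tau p.2 = p.1)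
    /\ (forall z, z \notin xs ++ ys -> tau z = z).
Proof.
elim: xs ys => [|x xs IH] [|y ys] //=.
  by move=> _ _; exists 1%g; split=> // z _; rewrite perm1.
move=> [sz]; rewrite mem_cat inE !negb_or cat_uniq /= => /andP[/and3P[xxs xy xys]].
rewrite negb_or -andbA => /and5P[uxs yxs hys yys uys].
have [|tau [t1 t2]] := IH ys sz; first by rewrite cat_uniq uxs hys.
have fx : tau x = x by apply: t2; rewrite mem_cat negb_or xxs.
have fy : tau y = y by apply: t2; rewrite mem_cat negb_or yxs.
exists (tperm x y * tau)%g; split=> [p|z].
  rewrite inE => /orP[/eqP -> /=|pz].
    by rewrite !permM tpermL tpermR.
  have p1 : p.1 \in xs by rewrite -[xs](@unzip1_zip _ _ _ ys) ?sz //; exact: map_f.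
  have p2 : p.2 \in ys by rewrite -[ys](@unzip2_zip _ _ xs) ?sz //; exact: map_f.
  have [e1 e2] := t1 p pz.
  have xp1 : x != p.1 by apply: contraNneq xxs => ->.
  have yp1 : y != p.1 by apply: contraNneq yxs => ->.
  have xp2 : x != p.2 by apply: contraNneq xys => ->.
  have yp2 : y != p.2 by apply: contraNneq yys => ->.
  by rewrite !permM !tpermD.
rewrite inE mem_cat inE !negb_or => /and4P[zx zxs zy zys].
by rewrite permM tpermD 1?eq_sym // t2 // mem_cat negb_or zxs.
Qed.

Section Absorption.
Variables (V : finType) (g h : rel V).
Hypothesis g_sym : symmetric g.
Implicit Types (t : V * V * V).

(* [v] may replace the center of [t], and the center may then be placed next to [u]. *)
Definition absorbs u v t := [&& g v t.1.1, g v t.2 & g u (center t)].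

(** The pairs are treated one by one. Those already treated block two centers each, so at least
    [2 * s] candidates remain for each of the two vertices of the next pair. The two candidate sets
    may coincide, but they still contain disjoint parts of size [s], between which [joined] finds
    the edge. *)
Lemma select_centers s N (T : seq (V * V * V)) (qs : seq (quad V)) :
  uniq (map (@center V) T) -> joined h s ->
  (forall u v, N <= count (absorbs u v) T) -> 2 * size qs + 2 * s <= N ->
  exists ys, [/\ size ys = size (removed qs), uniq ys,
     {subset ys <= map (@center V) T},
     forall p, p \in zip (removed qs) ys ->
       exists2 t, t \in T & [/\ center t = p.2, g p.1 t.1.1 & g p.1 t.2]
   & forall q, q \in qs -> exists c c', [/\ (q.1.2, c) \in zip (removed qs) ys,
       (q.2.1, c') \in zip (removed qs) ys, g q.1.1 c, g q.2.2 c' & h c c']].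
Proof.
move=> uT hj HN; elim: qs => [|q qs IH] /= qN; first by exists [::].
have [|ys [sy uy yT zp zq]] := IH; first lia.
pose X u v := [set z in map (@center V) (filter (absorbs u v) T)] :\: [set z in ys].
have szys : size ys = 2 * size qs.
  by rewrite sy /removed size_flatten; elim: (qs) => //= a l; rewrite /shape /= => ->; lia.
have XN u v : 2 * s <= #|X u v|.
  have : #|[set z in map (@center V) (filter (absorbs u v) T)]| = count (absorbs u v) T.
    rewrite cardsE (card_uniqP _) ?size_map ?size_filter //.
    by apply: subseq_uniq uT; apply/map_subseq/filter_subseq.
  have Ey : #|[set z in ys]| = 2 * size qs by rewrite cardsE (card_uniqP uy).
  have := subset_leq_card (subsetIr [set z in map (@center V) (filter (absorbs u v) T)] [set z in ys]).
  rewrite /X cardsD Ey; have := HN u v; lia.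
have [X0 X0X X0s] : exists2 B : {set V}, B \subset X q.1.1 q.1.2 & #|B| = s.
  by apply: subset_of_card; apply: leq_trans (XN _ _); lia.
have [|||c [c' [cX c'X hcc]]] := hj X0 (X q.2.2 q.2.1 :\: X0).
- by rewrite -setI_eq0; apply/eqP/setP => z; rewrite !inE; case: (z \in X0).
- by rewrite X0s.
- have := subset_leq_card (subsetIr (X q.2.2 q.2.1) X0).
  by rewrite cardsD; have := XN q.2.2 q.2.1; rewrite X0s; lia.
have {}cX0 := cX; move/(subsetP X0X): cX; rewrite !inE => /andP[cy].
move=> /mapP[t]; rewrite mem_filter => /andP[/and3P[t1 t2 t3] tT] Ec.
move: c'X; rewrite !inE => /andP[c'X0 /andP[c'y]].
move=> /mapP[t']; rewrite mem_filter => /andP[/and3P[t'1 t'2 t'3] t'T] Ec'.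
exists (c :: c' :: ys); split=> /=.
- by rewrite sy.
- rewrite inE negb_or cy c'y uy !andbT /=.
  by apply: contraNneq c'X0 => <-.
- move=> z; rewrite !inE => /or3P[/eqP ->|/eqP ->|/yT //].
    by rewrite Ec map_f.
  by rewrite Ec' map_f.
- move=> p; rewrite !inE => /or3P[/eqP ->|/eqP ->|/zp //].
    by exists t => //=; split.
  by exists t' => //=; split.
- move=> r; rewrite inE => /orP[/eqP ->|/zq [d [d' [z1 z2 z3 z4 z5]]]].
    by exists c, c'; rewrite !inE !eqxx !orbT Ec Ec' in hcc *; split.
  by exists d, d'; rewrite !inE z1 z2 !orbT; split.
Qed.

(* [tau] swaps each removed vertex with the center selected for it. *)
Lemma absorb s N cs (qs : seq (quad V)) :
  uniq (flatten cs ++ removed qs) -> all (cyclic h) cs -> quad_ends cs qs ->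
  joined h s ->
  (forall u v, N <= count (absorbs u v) (flatten (map (@triples V) cs))) ->
  2 * size qs + 2 * s <= N ->
  exists tau : {perm V}, forall u v, link cs qs u v -> u != v ->
    g (tau u) (tau v) || h (tau u) (tau v).
Proof.
set T := flatten (map (@triples V) cs) => ucq ch qe hj HN qN.
have uc : uniq (flatten cs) by move: ucq; rewrite cat_uniq => /andP[].
have uT := uniq_triples uc; rewrite -/T in uT.
have ucT : uniq (map (@center V) T).
  apply: subseq_uniq uT; elim: (T) => // t l IH.
  apply: (@cat_subseq _ [:: center t] _ (tseq t) _ _ IH).
  by rewrite sub1seq !inE eqxx orbT.
have [ys [sy uy yT zp zq]] := select_centers ucT hj HN qN.
have Tcs t : t \in T -> exists2 c, c \in cs & t \in triples c.
  by move=> /flatten_mapP[c]; exists c.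
have centerP z : z \in map (@center V) T ->
    exists c t, [/\ c \in cs, t \in triples c, t \in T & z = center t].
  by move=> /mapP[t tT ->]; have [c cc tc] := Tcs t tT; exists c, t.
have uniqc c : c \in cs -> uniq c by exact: uniq_flatten_mem uc.
have memc c z : c \in cs -> z \in c -> z \in flatten cs.
  by move=> cc zc; apply/flattenP; exists c.
have centerc c t : c \in cs -> t \in triples c -> center t \in c.
  by move=> cc tc; have [_ []] := triples_clink (uniqc c cc) tc.
have xsN z : z \in flatten cs -> z \notin removed qs.
  by move: ucq; rewrite cat_uniq => /and3P[_ /hasPn H _] zc; apply: contraL zc => /H.
have uxy : uniq (removed qs ++ ys).
  rewrite cat_uniq uy andbT; apply/andP; split.
    by move: ucq; rewrite cat_uniq => /and3P[].
  apply/hasPn => z /yT /centerP[c [t [cc tc tT ->]]].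
  by apply: xsN; apply: (memc _ _ cc); exact: centerc cc tc.
have [tau [tau1 tau2]] := swap_perm (esym sy) uxy.
have tauN z : z \in flatten cs -> z \notin ys -> tau z = z.
  by move=> zc zy; apply: tau2; rewrite mem_cat negb_or zy xsN.
have tauC z : z \in ys -> exists2 t, t \in T &
    [/\ center t = z, g (tau z) t.1.1 & g (tau z) t.2].
  move=> zy; have := zy; rewrite -[ys](@unzip2_zip _ _ (removed qs)) ?sy // => /mapP[p pz Ez].
  have [t tT [e1 e2 e3]] := zp p pz.
  by exists t => //; rewrite Ez (tau1 p pz).2.
have nbrN t : t \in T -> t.1.1 \notin ys /\ t.2 \notin ys.
  move=> tT; split; apply/negP => /yT /centerP[c [t' [_ _ t'T E]]];
    have [n1 n2] := center_nbr uT tT t'T; [exact: n1|exact: n2].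
have same c c' z : c \in cs -> c' \in cs -> z \in c -> z \in c' -> c = c'.
  exact: uniq_flatten_inj uc.
exists tau => u v [[c cc cl] uv|[q qq]].
  (* Inside a piece at most one of [u], [v] is moved, because the neighbours of a center are the
     outer vertices of its triple. *)
  have ucc := uniqc c cc; have [uinc vE] := cl.
  have vinc : v \in c by rewrite -vE mem_next.
  case uy' : (u \in ys).
    have [t tT [Et g1 g2]] := tauC u uy'; have [c' cc' tc'] := Tcs t tT.
    have E : c' = c by apply: (same _ _ _ cc' cc _ uinc); rewrite -Et; exact: centerc cc' tc'.
    have [_ [_ nE]] := triples_clink (uniqc c' cc') tc'.
    have Ev : v = t.2 by rewrite -vE -E -Et nE.
    have [_ t2N] := nbrN t tT.
    by rewrite [tau v]tauN ?(memc c) // Ev // g2.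
  case vy' : (v \in ys).
    have [t tT [Et g1 g2]] := tauC v vy'; have [c' cc' tc'] := Tcs t tT.
    have E : c' = c by apply: (same _ _ _ cc' cc _ vinc); rewrite -Et; exact: centerc cc' tc'.
    have [[_ nE] _] := triples_clink (uniqc c' cc') tc'.
    have Eu : u = t.1.1.
      by rewrite -(prev_next ucc u) vE -Et -nE E (prev_next ucc).
    have [t1N _] := nbrN t tT.
    rewrite g_sym [tau u]tauN ?(memc c) //; last by rewrite uy'.
    by rewrite Eu g1.
  (* Neither vertex is moved. A one-vertex piece is [cyclic] by convention only, but its single link
     is a loop, excluded by [u != v]. *)
  rewrite !tauN ?(memc c) ?uy' ?vy' //.
  case/orP: (allP ch c cc) => [|cyc]; last by rewrite -vE (next_cycle cyc uinc) orbT.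
  move: uinc uv vE; case: (c) => [|a [|]] //; rewrite inE => /eqP -> /[swap].
  by rewrite /= eqxx => ->; rewrite eqxx.
(* Ends of pieces stay fixed, so the three pairs become an edge of [h] between the two selected
   centers with an edge of [g] on either side. *)
have [[c cc cl] [d dd dh]] := qe q qq.
have [y [y' [z1 z2 g1 g2 h1]]] := zq q qq.
have qN1 : tau q.1.1 = q.1.1.
  apply: tauN.
    by apply: (memc _ _ cc); case: cl => s' ->; rewrite mem_rcons mem_head.
  apply/negP => /yT /centerP[c' [t [cc' tc' _ Ez]]].
  have E : c' = c.
    apply: (same _ _ _ cc' cc (centerc _ _ cc' tc') _); rewrite -Ez.
    by case: cl => s' ->; rewrite mem_rcons mem_head.
  by rewrite Ez -E in cl; exact: triples_not_last (uniqc c' cc') tc' cl.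
have qN2 : tau q.2.2 = q.2.2.
  apply: tauN.
    by apply: (memc _ _ dd); case: dh => s' ->; rewrite mem_head.
  apply/negP => /yT /centerP[c' [t [cc' tc' _ Ez]]].
  have E : c' = d.
    apply: (same _ _ _ cc' dd (centerc _ _ cc' tc') _); rewrite -Ez.
    by case: dh => s' ->; rewrite mem_head.
  by rewrite Ez -E in dh; exact: triples_not_head (uniqc c' cc') tc' dh.
have [/= tx _] := tau1 _ z1; have [/= tx' _] := tau1 _ z2.
case=> [] E _.
- have [-> ->] : u = q.1.1 /\ v = q.1.2 by rewrite -E.
  by rewrite qN1 tx g1.
- have [-> ->] : u = q.1.2 /\ v = q.2.1 by case: E.
  by rewrite tx tx' h1 orbT.
- have [-> ->] : u = q.2.1 /\ v = q.2.2 by rewrite -E.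
  by rewrite qN2 tx' g_sym g2.
Qed.

End Absorption.

(** * From packings to spanning embeddings *)

Definition pairs (V : finType) : {set {set V}} := [set e : {set V} | #|e| == 2].

Definition eadj (V : finType) (A : {set {set V}}) : rel V := fun u v => [set u; v] \in A.

Lemma eadj_sym (V : finType) (A : {set {set V}}) : symmetric (eadj A).
Proof. by move=> u v; rewrite /eadj setUC. Qed.

Lemma pairs2 (V : finType) (u v : V) : ([set u; v] \in pairs V) = (u != v).
Proof. by rewrite inE cards2; case: (u != v). Qed.

Lemma set2_inj (V : finType) (a b c d : V) : [set a; b] = [set c; d] ->
  a != d -> a = c /\ b = d.
Proof.
move=> E ad; have : a \in [set c; d] by rewrite -E !inE eqxx.
rewrite !inE (negPf ad) orbF => /eqP ac; split=> //.
have : d \in [set a; b] by rewrite E !inE eqxx orbT.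
by rewrite !inE eq_sym (negPf ad) => /eqP.
Qed.

Definition has_cycle (V : finType) (A : {set {set V}}) (U : {set V}) l : Prop :=
  exists c, [/\ size c = l, uniq c, cyclic (eadj A) c & {subset c <= U}].

Definition cycle_rich (V : finType) (w L : nat) (A : {set {set V}}) : Prop :=
  forall l (U : {set V}), (0 < l <= L)%N -> (w <= #|U|)%N -> has_cycle A U l.

Lemma triples_map (T U : eqType) (f : T -> U) c :
  triples (map f c) = [seq (f t.1.1, f t.1.2, f t.2) | t <- triples c].
Proof.
have [n] := ubnP (size c); elim: n c => // n IH [|a [|y [|b c]]] //= cn.
by rewrite IH //; lia.
Qed.

Lemma cyclic_map (U W : finType) (f : U -> W) (e : rel W) c :
  cyclic e (map f c) = cyclic (relpre f e) c.
Proof. by case: c => // x c; rewrite /cyclic /= size_map -map_rcons path_map. Qed.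

Lemma perm_map_lift (T U : eqType) (f : T -> U) (s : seq T) (t : seq U) :
  perm_eq (map f s) t -> exists2 s', perm_eq s s' & map f s' = t.
Proof.
elim: t s => [|y t IH] s st.
  by exists [::] => //; move/perm_size: st; rewrite size_map => /size0nil ->.
have /mapP[x xs Ey] : y \in map f s by rewrite (perm_mem st) mem_head.
have ps := perm_to_rem xs.
have [|s' ss' Es'] := IH (rem x s).
  rewrite -(perm_cons y) -(permPr st) Ey -[_ :: _]/(map f (x :: rem x s)).
  by apply: perm_map; rewrite perm_sym.
exists (x :: s') => /=; last by rewrite Es' Ey.
by apply: perm_trans ps _; rewrite perm_cons.
Qed.

Lemma map_unflatten (T U : eqType) (f : T -> U) (cs : seq (seq T)) (ds : seq (seq U)) :
  map size ds = map size cs -> flatten ds = map f (flatten cs) -> ds = map (map f) cs.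
Proof.
move=> Es Ef; rewrite -[ds]flattenK -[cs in RHS]flattenK map_reshape -Ef.
by rewrite /shape Es.
Qed.

Lemma joined_pullback (V W : finType) (f : V -> W) (e : rel W) s :
  injective f -> joined e s -> joined (relpre f e) s.
Proof.
move=> fI je X Y dXY sX sY.
have [|||x [y [/imsetP[a aX ->] /imsetP[b bY ->] eab]]] := je (f @: X) (f @: Y).
- rewrite -setI_eq0; apply/eqP/setP => z; rewrite !inE; apply/negbTE/negP.
  case/andP => /imsetP[a aX ->]; rewrite mem_imset // => aY.
  by rewrite (disjointFr dXY aX) in aY.
- by rewrite card_imset.
- by rewrite card_imset.
by exists a, b.
Qed.

Section Embedding.
Variables (V : finType) (G : sgraph V) (s w L t M : nat).

Lemma adj_sym (H : sgraph V) : symmetric (adj H).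
Proof. by move=> u v; rewrite /adj setUC. Qed.

Lemma adj_irr (H : sgraph V) : irreflexive (adj H).
Proof.
move=> u; apply/negP => uu; have /forall_inP/(_ _ uu) := edgesP H.
by rewrite cards2 eqxx.
Qed.

(** [k l] is the number of pieces with [l] vertices. Recording multiplicities instead of a sequence
    of sizes leaves only [#|V|.+1 ^ L.+1] shapes for the union bound. *)
Definition shape_of (k : {ffun 'I_L.+1 -> 'I_#|V|.+1}) : seq nat :=
  flatten [seq nseq (k l) (l : nat) | l <- enum 'I_L.+1].

Definition all_triples (ds : seq (seq V)) := flatten [seq triples d | d <- ds].

Definition packs (sh : seq nat) (A : {set {set V}}) (ds : seq (seq V)) : Prop :=
  [/\ map size ds = sh, uniq (flatten ds) & all (cyclic (eadj A)) ds].

Definition absorbing (ds : seq (seq V)) : Prop :=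
  forall u v, t <= count (absorbs (adj G) u v) (all_triples ds).

(** Relabelling carries packings to packings with equally many triples, so the first clause is
    invariant under it and only the second depends on [G]. *)
Definition bad_shape k (A : {set {set V}}) : Prop :=
  (exists ds, packs (shape_of k) A ds /\ M <= size (all_triples ds)) /\
  ~ exists ds, packs (shape_of k) A ds /\ absorbing ds.

Definition completes (A : {set {set V}}) : Prop :=
  forall F : sgraph V, max_degree F <= 2 -> exists2 f : V -> V, injective f &
    forall u v, adj F u v -> adj G (f u) (f v) || eadj A (f u) (f v).

Lemma shape_ofP (ls : seq nat) : all (fun l => 0 < l <= L) ls -> sumn ls <= #|V| ->
  exists k, perm_eq ls (shape_of k).
Proof.
move=> lsL lsn.
have cn l : count_mem l ls < #|V|.+1.
  rewrite ltnS (leq_trans (count_size _ _)) //; apply: leq_trans lsn.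
  by elim: ls lsL => //= a ls IH /andP[/andP[a0 _] /IH]; clear -a0; lia.
exists [ffun l : 'I_L.+1 => Ordinal (cn l)].
apply/allP => x _ /=; apply/eqP.
rewrite /shape_of count_flatten -map_comp.
rewrite (eq_map (g := fun l : 'I_L.+1 => (l == x :> nat) * count_mem (l : nat) ls)); last first.
  by move=> l /=; rewrite count_nseq ffunE.
rewrite sumnE big_map big_enum /=.
have [xL|xL] := ltnP x L.+1.
  rewrite (bigD1 (Ordinal xL)) //= eqxx mul1n big1 ?addn0 // => l lx.
  by rewrite (_ : (l == x :> nat) = false) //; apply/negbTE.
rewrite big1 => [|l _]; last first.
  by rewrite (_ : (l == x :> nat) = false) //; have := ltn_ord l; clear -xL; lia.
apply/count_memPn; apply/negP => /(allP lsL) /andP[_].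
by clear -xL; lia.
Qed.

(** The hypothesis on [r] collects the demands on the number of removed pairs over the range that
    [cut_cycles] leaves open: enough leftover vertices for the greedy packing, at least [M] triples,
    and enough absorbing triples for the selection of centers. *)
Lemma completion r0 (A : {set {set V}}) : 3 < L ->
  (forall r, r0 <= r \/ #|V| - 2 <= L.+2 * r -> L.-1 * r <= 2 * #|V| + L.-1 * r0 ->
     [/\ w <= 2 * r, 5 * M + 4 * r + 2 <= #|V| & 2 * r + 2 * s <= t]) ->
  joined (eadj A) s -> cycle_rich w L A -> (forall k, ~ bad_shape k A) ->
  completes A.
Proof.
move=> L3 Hr jA rA nbad F degF.
have deg2 u : #|[set v | adj F u v]| <= 2.
  by apply: leq_trans degF; rewrite /max_degree (leq_bigmax (F := degree F) u).
have [cs0 [z [pz c3 z2 cover]]] := cycle_cover (@adj_sym F) (@adj_irr F) deg2.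
have uz : uniq (z ++ flatten cs0) by rewrite (perm_uniq pz) enum_uniq.
have u0 : uniq (flatten cs0) by move: uz; rewrite cat_uniq => /and3P[].
have sz : size z + size (flatten cs0) = #|V| by rewrite -size_cat (perm_size pz) -cardE.
have [cs [qs [h1 h2 h3 h4 [h5 h6 h7]]]] := cut_cycles r0 L3 u0 c3.
(* The exceptional sequence [z], if not empty, becomes a piece of its own. *)
have [cs1 [fl1 all1 cnt1 sub1 zin]] : exists cs1, [/\ flatten cs1 = z ++ flatten cs,
    all (fun c => 0 < size c <= L) cs1, count (fun c => size c < 3) cs1 <= (size qs).+1,
    {subset cs <= cs1} & 0 < size z -> z \in cs1].
  case: (posnP (size z)) => [/size0nil ->|z0].
    by exists cs; split=> //; exact: leqW.
  exists (z :: cs); split=> //=.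
  - by rewrite z0 h2 andbT (leq_trans z2) // ltnW // ltnW.
  - by rewrite ltnS z2 add1n ltnS.
  - by move=> c cc; rewrite inE cc orbT.
  - by rewrite mem_head.
have pall : perm_eq (flatten cs1 ++ removed qs) (enum V).
  rewrite fl1 -catA; apply: perm_trans pz; by rewrite perm_cat2l.
have szr : size (removed qs) = 2 * size qs.
  rewrite /removed size_flatten; elim: (qs) => //= a l; rewrite /shape /= => ->.
  by rewrite mulnS.
have sz1 : size (flatten cs1) + 2 * size qs = #|V|.
  by rewrite -szr -size_cat (perm_size pall) -cardE.
have [||Hw HM Ht] := Hr (size qs).
- case: h5 => h5; [by left|right; apply: leq_trans h5].
  by rewrite -sz leq_subLR leq_add2r.
- apply: leq_trans h6 _; rewrite leq_add2r leq_mul2l /= -sz; exact: leq_addl.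
have [||k pk] := @shape_ofP (map size cs1).
- by rewrite all_map.
- by rewrite -size_flatten -sz1 leq_addr.
(* The pieces are reordered so that their sizes form the canonical list of the shape. *)
have [cs2 p12 E2] := perm_map_lift pk.
have mem12 c : c \in cs1 -> c \in cs2 by rewrite (perm_mem p12).
have pf2 : perm_eq (flatten cs1) (flatten cs2) by exact: perm_flatten.
have u2 : uniq (flatten cs2 ++ removed qs).
  rewrite -(perm_uniq (_ : perm_eq (flatten cs1 ++ removed qs) _)); last by rewrite perm_cat2r.
  by rewrite (perm_uniq pall) enum_uniq.
have mem2 u : u \in flatten cs2 ++ removed qs.
  have pu : perm_eq (flatten cs2 ++ removed qs) (enum V).
    by apply: perm_trans pall; rewrite perm_cat2r perm_sym.
  by rewrite (perm_mem pu) mem_enum.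
have sumk : sumn (shape_of k) = size (flatten cs1).
  by rewrite -E2 -[sumn _]size_flatten (perm_size pf2).
have [ds0 [pk1 pk2 pk3 _]] : exists ds, [/\ map size ds = shape_of k, uniq (flatten ds),
    all (cyclic (eadj A)) ds & {subset flatten ds <= [set: V]}].
  apply: (@greedy_packing _ _ w) => [l U|].
    rewrite -E2 => /mapP[c cc ->] wU; apply: rA => //.
    by apply: (allP all1); rewrite (perm_mem p12).
  by rewrite sumk cardsT -sz1 leq_add2l.
(* With [r] removed pairs, [#|V| - 2 * r] vertices are packed and at most [r + 1] pieces have fewer
   than three vertices. So five times the number of triples is at least [#|V| - 4 * r - 2]. *)
have big0 : M <= size (all_triples ds0).
  have b1 : forall ds : seq (seq V), size (flatten ds) <=
      5 * size (all_triples ds) + 2 * count (fun c => size c < 3) ds.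
    elim=> //= d ds IH; rewrite /all_triples /= !size_cat.
    by rewrite !mulnDr addnACA leq_add // size_triples.
  have b2 : count (fun c => size c < 3) ds0 = count (fun c => size c < 3) cs1.
    transitivity (count (fun l => l < 3) (map size ds0)); first by rewrite count_map.
    by rewrite pk1 -E2 count_map (elimT seq.permP p12).
  have b3 : size (flatten ds0) = size (flatten cs1) by rewrite size_flatten /shape pk1 sumk.
  have := b1 ds0; rewrite b2 b3; clear -cnt1 HM sz1; lia.
have [ds [[d1 d2 d3] dabs]] : exists ds, packs (shape_of k) A ds /\ absorbing ds.
  by apply: contrapT => nex; apply: (nbad k); split=> //; exists ds0.
(* [X] and [Y] both enumerate [V]. Matching them position by position sends each piece onto its
   cycle and the removed vertices arbitrarily onto the leftover ones; both graphs are then pulled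
   back along [f]. *)
pose X := flatten cs2 ++ removed qs.
pose Y := flatten ds ++ enum (~: [set x in flatten ds]).
have sfd : size (flatten ds) = size (flatten cs2).
  by rewrite !size_flatten /shape d1 E2.
have uY : uniq Y.
  rewrite cat_uniq d2 enum_uniq andbT /=; apply/hasPn => x.
  by rewrite mem_enum !inE.
have sY : size Y = size X.
  have -> : size X = #|V|.
    by rewrite -(card_uniqP u2); apply: eq_card => x; rewrite mem2.
  rewrite -(card_uniqP uY); apply: eq_card => x; rewrite mem_cat mem_enum !inE.
  by case: (x \in _).
pose f u := nth u Y (index u X).
have fI : injective f.
  move=> u v /eqP; rewrite /f (set_nth_default u v) ?sY ?index_mem ?mem2 //.
  rewrite nth_uniq ?sY ?index_mem ?mem2 // => /eqP E.
  by rewrite -(nth_index u (mem2 u)) E nth_index.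
have fE : flatten ds = map f (flatten cs2).
  have [V0|[x0 _]] := set_0Vmem [set: V].
    suff E (l : seq V) : l = [::] by rewrite (E (flatten ds)) (E (flatten cs2)).
    by case: l => // x l; have := in_setT x; rewrite V0 inE.
  apply: (@eq_from_nth _ x0); rewrite ?size_map // => i ids.
  have ics : i < size (flatten cs2) by rewrite -sfd.
  rewrite (nth_map x0) // /f index_cat mem_nth // index_uniq //; last first.
    by move: u2; rewrite cat_uniq => /andP[].
  by rewrite nth_cat ids (set_nth_default x0).
have Eds : ds = map (map f) cs2 by apply: map_unflatten; rewrite ?d1 ?E2.
pose g' : rel V := relpre f (adj G); pose h' : rel V := relpre f (eadj A).
have g's : symmetric g' by move=> u v; exact: adj_sym.
have c2 : all (cyclic h') cs2.
  apply/allP => c cc; rewrite -cyclic_map; apply: (allP d3).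
  by rewrite Eds map_f.
have q2 : quad_ends cs2 qs by apply: quad_ends_sub h4 => c /sub1 /mem12.
have cnt u v : t <= count (absorbs g' u v) (flatten (map (@triples V) cs2)).
  have := dabs (f u) (f v); rewrite /all_triples Eds -map_comp.
  rewrite (eq_map (fun c => triples_map f c)).
  rewrite (_ : flatten _ = [seq (f p.1.1, f p.1.2, f p.2) | p <- flatten (map (@triples V) cs2)]).
    by rewrite count_map.
  by rewrite map_flatten -map_comp.
have [tau tauP] := absorb g's u2 c2 q2 (joined_pullback fI jA) cnt Ht.
exists (f \o tau) => [|u v uv]; first exact: inj_comp fI (@perm_inj _ tau).
have uv' : u != v by apply: contraTneq uv => ->; rewrite adj_irr.
have lk a b : (exists2 c, c \in z :: cs0 & clink c a b) -> link cs2 qs a b.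
  move=> [c]; rewrite inE => /orP[/eqP ->|cc] cl.
    left; exists z => //; apply/mem12/zin.
    by case: cl; case: (z).
  have [[d dd dl]|] := h3 a b (ex_intro2 _ _ c cc cl); last by right.
  by left; exists d => //; apply/mem12/sub1.
have [c cc [cl|cl]] := cover u v uv.
  by apply: tauP => //; apply: lk; exists c.
rewrite adj_sym eadj_sym; apply: tauP; last by rewrite eq_sym.
by apply: lk; exists c.
Qed.

End Embedding.

(* [1 / a] bounds the minimum degree density, [1 / Q] the probability that a
   random triple is hit, [n %/ T0] the number of absorbing triples per pair of
   vertices, [L] the size of the pieces, and [n %/ K] the sizes at which
   expansion is required; [r] is the number of removed pairs. *)
Lemma parameters (a n Q T0 L K : nat) : 0 < a -> 64 * a ^ 3 = Q -> 32 * a * Q = T0 ->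
  (16 * T0).+1 = L -> 16 * L ^ 2 = K -> K <= n ->
  [/\ forall r, n %/ L <= r \/ n - 2 <= L.+2 * r ->
        L.-1 * r <= 2 * n + L.-1 * (n %/ L) ->
        [/\ n %/ L <= 2 * r, 5 * (4 * Q * (n %/ T0)) + 4 * r + 2 <= n
          & 2 * r + 2 * (n %/ K) <= n %/ T0],
      (n %/ K) * L + L * (2 * (n %/ K)) + 2 * (n %/ K) <= n %/ L,
      0 < n %/ K
    & forall d, n <= a * d -> (n %/ (4 * a)).+1 + 3 * (4 * Q * (n %/ T0)) <= d].
Proof.
move=> a0 EQ ET EL EK Kn.
have Q64 : 64 <= Q by rewrite -EQ -[X in X <= _]muln1 leq_mul2l expn_gt0 a0.
have T64 : 64 * a <= T0 by rewrite -ET; nia.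
have LT : L.-1 = 16 * T0 by rewrite -EL.
have L1 : 1024 < L by rewrite -EL; lia.
have KL : K = 16 * L * L by rewrite -EK expnS expn1 mulnA.
have K0 : 0 < K by rewrite KL; nia.
have T0p : 0 < T0 by lia.
have Lp : 0 < L by lia.
have tn : T0 * (n %/ T0) <= n by rewrite mulnC leq_trunc_div.
have tn' : n < T0 * (n %/ T0).+1 by rewrite mulnC ltn_ceil.
have wn : L * (n %/ L) <= n by rewrite mulnC leq_trunc_div.
have wn' : n < L * (n %/ L).+1 by rewrite mulnC ltn_ceil.
have sn : K * (n %/ K) <= n by rewrite mulnC leq_trunc_div.
have s0 : 0 < n %/ K by rewrite divn_gt0.
have Kbig : 64 * T0 <= K.
  by rewrite KL; apply: leq_trans (leq_pmulr _ Lp); rewrite -EL; clear; lia.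
have QT : 8 * a * (4 * Q * (n %/ T0)) <= n.
  have -> : 8 * a * (4 * Q * (n %/ T0)) = 32 * a * Q * (n %/ T0) by ring.
  by rewrite ET.
move: (n %/ T0) (n %/ L) (n %/ K) tn tn' wn wn' sn s0 QT => t w s tn tn' wn wn' sn s0.
rewrite -mulnA; set M := 4 * Q * t => QT.
have aM : M <= a * M by rewrite leq_pmull.
split=> //.
(* The upper bound on [r] gives [16 * T0 * r <= 3 * n], so that [2 * r] stays below half of
   [n / T0]. *)
- move=> r Hr; rewrite LT => rle.
  have r3 : 16 * T0 * r <= 3 * n.
    apply: leq_trans rle _; have : 16 * T0 * w <= L * w by rewrite leq_mul2r -EL leqnSn orbT.
    by move=> h; clear -h wn; lia.
  have rn : 1024 * r <= 3 * n.
    by apply: leq_trans r3; rewrite leq_mul2r; apply/orP; right; clear -T64 a0; lia.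
  split.
  + case: Hr => [h|h]; first by clear -h; lia.
    rewrite leqNgt; apply/negP => wr.
    have : L * (2 * r).+1 <= n by apply: leq_trans wn; rewrite leq_mul2l wr orbT.
    have h3 : 1024 * r <= L * r by rewrite leq_mul2r ltnW ?orbT.
    have e1 : L * (2 * r).+1 = L + 2 * (L * r) by rewrite mulnS; congr (_ + _); ring.
    have e2 : L.+2 * r = r + (r + L * r) by rewrite !mulSn.
    rewrite e1; move: h; rewrite e2; move: (L * r) h3; clear -L1; lia.
  + by move: QT aM rn Kn Kbig T64; clear -a0; lia.
  + rewrite leqNgt; apply/negP => h.
    have h1 : T0 * t.+1 <= T0 * (2 * r + 2 * s) by rewrite leq_mul2l h orbT.
    have h2 : 64 * T0 * s <= n by apply: leq_trans sn; rewrite leq_mul2r Kbig orbT.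
    by move: h1 h2 r3 tn'; rewrite mulnDr !(mulnCA T0) -!mulnA; clear -s0 T0p; lia.
- rewrite leqNgt; apply/negP => h.
  have h1 : 16 * L * w.+1 <= 16 * L * (s * L + L * (2 * s) + 2 * s) by rewrite leq_mul2l h orbT.
  have E1 : 16 * L * (s * L + L * (2 * s) + 2 * s) = 3 * (K * s) + 32 * L * s by rewrite KL; ring.
  have h2 : 32 * L * s <= K * s by rewrite KL leq_mul2r; apply/orP; right; clear -L1; nia.
  move: h1; rewrite E1 -mulnA; move: (L * w.+1) wn' h2 sn s0 Kn K0; clear.
  by move: (K * s); lia.
- move=> d nd; rewrite leqNgt; apply/negP => h.
  have h1 : a * d.+1 <= a * ((n %/ (4 * a)).+1 + 3 * M) by rewrite leq_mul2l h orbT.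
  have h2 : 4 * a * (n %/ (4 * a)) <= n by rewrite mulnC leq_trunc_div.
  move: h1 h2 QT nd Kbig T64 Kn; rewrite mulnDr !mulnS -!mulnA (mulnCA a 3).
  by clear -a0; lia.
Qed.

Import Order.TTheory GRing.Theory Num.Theory.
Local Open Scope ring_scope.

(** * Random subsets and Janson's inequality *)

Lemma disjoint_setDr (T : finType) (A B : {set T}) : [disjoint A & B :\: A].
Proof. by rewrite -setI_eq0; apply/eqP/setP => x; rewrite !inE; case: (x \in A). Qed.

Lemma ler_bool (R : numDomainType) (b1 b2 : bool) : (b1 -> b2) -> b1%:R <= b2%:R :> R.
Proof. by case: b1 b2 => [] [] // /(_ isT). Qed.

Section RandomSubset.
Variables (R : realFieldType) (T : finType) (p : R).
Implicit Types (A B D S : {set T}) (f g : {set T} -> R).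

Definition rs_mass D A : R := \prod_(e in D) (if e \in A then p else 1 - p).

Definition rs_exp D f : R := \sum_(A : {set T} | A \subset D) rs_mass D A * f A.

Lemma rs_exp0 f : rs_exp set0 f = f set0.
Proof.
rewrite /rs_exp (big_pred1 set0) => [|A]; last by rewrite subset0.
by rewrite /rs_mass big_set0 mul1r.
Qed.

Lemma eq_rs_exp D f g :
  (forall A, A \subset D -> f A = g A) -> rs_exp D f = rs_exp D g.
Proof. by move=> fg; apply: eq_bigr => A AD; rewrite fg. Qed.

(** Conditioning on whether [e] is chosen, the recursion behind the inductions on [D]. *)
Lemma rs_expU1 e D f : e \notin D ->
  rs_exp (e |: D) f = p * rs_exp D (fun A => f (e |: A)) + (1 - p) * rs_exp D f.
Proof.
move=> eD; rewrite /rs_exp (bigID (fun A : {set T} => e \in A)) /=.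
congr (_ + _).
- rewrite (reindex_onto (fun A : {set T} => e |: A) (fun A => A :\ e)) /=; last first.
    by move=> A /andP[_ eA]; rewrite setD1K.
  rewrite big_distrr /=; apply: eq_big => [A|A].
    rewrite setU11 andbT; apply/andP/idP => [[]|AD].
      move=> /subsetP sA /eqP eqA; rewrite -eqA; apply/subsetP => x.
      rewrite !inE => /andP[xe]; rewrite (negPf xe) /= => xA.
      by have := sA x; rewrite !inE xA (negPf xe) orbT /=; apply.
    split; first exact: setUS.
    by rewrite setU1K //; apply: contra eD; apply/subsetP: e.
  case/andP=> _ /eqP eA; rewrite mulrA; congr (_ * _).
  have eA' : e \notin A by rewrite -eA !inE eqxx.
  rewrite /rs_mass big_setU1 //= setU11; congr (_ * _).
  apply: eq_bigr => x xD; rewrite !inE; case: eqP => // xe.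
  by rewrite xe in xD; rewrite xD in eD.
- rewrite big_distrr /=; apply: eq_big => [A|A].
    apply/andP/idP => [[/subsetP sA eA]|AD].
      apply/subsetP => x xA; have := sA x xA; rewrite !inE.
      by case: eqP => // xe; rewrite -xe xA in eA.
    split; last by apply: contra eD; apply/subsetP: e.
    by apply: (subset_trans AD); rewrite subsetUr.
  case/andP=> _ eA; rewrite mulrA; congr (_ * _).
  by rewrite /rs_mass big_setU1 //= (negPf eA).
Qed.

Lemma rs_exp_ind (P : {set T} -> Prop) :
  P set0 -> (forall e D, e \notin D -> P D -> P (e |: D)) -> forall D, P D.
Proof.
move=> P0 PU D; elim: {D}_.+1 {-2}D (ltnSn #|D|) => // n IH D.
have [->|[e eD]] := set_0Vmem D; first by move=> _; exact: P0.
move=> Dn; rewrite -(setD1K eD); apply: PU; first by rewrite !inE eqxx.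
by apply: IH; move: Dn; rewrite (cardsD1 e D) eD.
Qed.

Lemma rs_exp_sum (I : Type) (r : seq I) (P : pred I) D (F : I -> {set T} -> R) :
  rs_exp D (fun A => \sum_(i <- r | P i) F i A) =
  \sum_(i <- r | P i) rs_exp D (F i).
Proof.
by rewrite /rs_exp exchange_big; apply: eq_bigr => A _; rewrite big_distrr.
Qed.

Lemma rs_expD D f g : rs_exp D (fun A => f A + g A) = rs_exp D f + rs_exp D g.
Proof. by rewrite /rs_exp -big_split; apply: eq_bigr => A _; rewrite mulrDr. Qed.

Lemma rs_expB D f g : rs_exp D (fun A => f A - g A) = rs_exp D f - rs_exp D g.
Proof.
by rewrite /rs_exp -sumrB; apply: eq_bigr => A _; rewrite mulrBr.
Qed.

Lemma rs_expZ D (c : R) f : rs_exp D (fun A => c * f A) = c * rs_exp D f.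
Proof. by rewrite /rs_exp big_distrr; apply: eq_bigr => A _; rewrite mulrCA. Qed.

Lemma rs_exp_cst D (c : R) : rs_exp D (fun=> c) = c.
Proof.
elim/rs_exp_ind: D => [|e D eD IH]; first exact: rs_exp0.
by rewrite rs_expU1 // IH -mulrDl addrC subrK mul1r.
Qed.

Lemma rs_expU D1 D2 f : [disjoint D1 & D2] ->
  rs_exp (D1 :|: D2) f =
  rs_exp D1 (fun A => rs_exp D2 (fun B => f (A :|: B))).
Proof.
elim/rs_exp_ind: D1 f => [|e D eD IH] f dis.
  by rewrite set0U rs_exp0; apply: eq_rs_exp => A _; rewrite set0U.
have eD2 : e \notin D2 by rewrite (disjointFr dis) // setU11.
have dis' : [disjoint D & D2].
  by apply: disjointWl dis; rewrite subsetUr.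
rewrite -setUA !rs_expU1 ?inE ?negb_or ?eD //; congr (_ * _ + _ * _); last exact: IH.
by rewrite IH //; apply: eq_rs_exp => A _; apply: eq_rs_exp => B _; rewrite setUA.
Qed.

Lemma rs_exp_reindex (h : T -> T) D f : injective h -> h @: D = D ->
  rs_exp D (fun A => f (h @: A)) = rs_exp D f.
Proof.
move=> hI hD; rewrite [RHS]/rs_exp.
have himI : injective (fun A : {set T} => h @: A) by exact: imset_inj.
rewrite (reindex_inj himI) /=; apply: eq_big => [A|A AD].
  by rewrite -{2}hD; apply/idP/idP=> [/imsetS //|/subsetP hA]; last first;
    apply/subsetP => x xA; have /imsetP[y yD /hI ->] := hA _ (imset_f h xA).
congr (_ * _); rewrite /rs_mass -{2}hD big_imset /=; last by move=> x y _ _; exact: hI.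
by apply: eq_bigr => x _; rewrite mem_imset.
Qed.

Hypothesis p01 : 0 <= p <= 1.
Let p0 : 0 <= p. Proof. by case/andP: p01. Qed.
Let q0 : 0 <= 1 - p. Proof. by rewrite subr_ge0; case/andP: p01. Qed.

Lemma rs_mass_ge0 D A : 0 <= rs_mass D A.
Proof. by apply: prodr_ge0 => e _; case: ifP. Qed.

Lemma ler_rs_exp D f g :
  (forall A, A \subset D -> f A <= g A) -> rs_exp D f <= rs_exp D g.
Proof.
by move=> fg; apply: ler_sum => A AD; apply: ler_wpM2l (fg _ AD); exact: rs_mass_ge0.
Qed.

Definition increasing f := forall A B, A \subset B -> f A <= f B.

Lemma increasing_setU1 e f : increasing f -> increasing (fun A => f (e |: A)).
Proof. by move=> fI A B AB; apply: fI; exact: setUS. Qed.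

Lemma ler_rs_exp_setU1 e D f : increasing f ->
  rs_exp D f <= rs_exp D (fun A => f (e |: A)).
Proof. by move=> fI; apply: ler_rs_exp => A _; apply: fI; exact: subsetUr. Qed.

(** Conditioning on one element leaves a two-point space, where the covariance is
    [p * (1 - p) * ((f1 - f0) * (g1 - g0))] and the two differences have opposite signs. *)
Lemma harris D f g : increasing f -> increasing (fun A => - g A) ->
  rs_exp D (fun A => f A * g A) <= rs_exp D f * rs_exp D g.
Proof.
elim/rs_exp_ind: D f g => [|e D eD IH] f g fI gI; first by rewrite !rs_exp0.
rewrite !rs_expU1 //.
have fI' := increasing_setU1 e fI; have gI' := increasing_setU1 e gI.
have := IH _ _ fI gI; have := IH _ _ fI' gI'.
have := ler_rs_exp_setU1 e D fI.
have : rs_exp D (fun A => g (e |: A)) <= rs_exp D g.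
  by apply: ler_rs_exp => A _; rewrite -lerN2; apply: gI; exact: subsetUr.
set fg1 := rs_exp D (fun A => f (e |: A) * g (e |: A)); set fg0 := rs_exp D (fun A => f A * g A).
set f1 := rs_exp D (fun A => f (e |: A)); set g1 := rs_exp D (fun A => g (e |: A)).
set f0 := rs_exp D f; set g0 := rs_exp D g => g10 f01 h1 h0.
have : 0 <= p * (1 - p) * ((f1 - f0) * (g0 - g1)).
  by apply: mulr_ge0; apply: mulr_ge0; rewrite ?subr_ge0 // -subr_ge0.
have : 0 <= p * (f1 * g1 - fg1) by rewrite mulr_ge0 // subr_ge0.
have : 0 <= (1 - p) * (f0 * g0 - fg0) by rewrite mulr_ge0 // subr_ge0.
lra.
Qed.

Definition contains S A : R := (S \subset A)%:R.

Lemma increasing_contains S : increasing (contains S).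
Proof.
move=> A B AB; rewrite /contains; case SA: (S \subset A) => //.
by rewrite (subset_trans SA AB).
Qed.

Lemma rs_exp_contains S : rs_exp S (contains S) = p ^+ #|S|.
Proof.
rewrite /rs_exp (bigD1 S) //= big1 ?addr0 => [|A /andP[AS nAS]]; last first.
  rewrite /contains; case SA: (S \subset A); last by rewrite mulr0.
  by rewrite eqEsubset AS SA in nAS.
rewrite /contains subxx mulr1 /rs_mass.
rewrite (eq_bigr (fun=> p)) ?prodr_const //.
by move=> e ->.
Qed.

Lemma rs_exp_contains_indep S D g : S \subset D ->
  (forall A, g (A :\: S) = g A) ->
  rs_exp D (fun A => contains S A * g A) = p ^+ #|S| * rs_exp D g.
Proof.
move=> SD gS; rewrite -(setID D S) (setIidPr SD).
have dis : [disjoint S & D :\: S] := disjoint_setDr S D.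
have gE A B : A \subset S -> B \subset D :\: S -> g (A :|: B) = g B.
  move=> AS BD; rewrite -gS -[RHS]gS setDUl; congr g.
  by move: AS; rewrite -setD_eq0 => /eqP ->; rewrite set0U.
rewrite !rs_expU //.
rewrite [X in _ = _ * X](_ : _ = rs_exp (D :\: S) g); last first.
  rewrite -[RHS](rs_exp_cst S); apply: eq_rs_exp => A AS.
  by apply: eq_rs_exp => B BD; exact: gE.
rewrite -rs_exp_contains mulrC -rs_expZ; apply: eq_rs_exp => A AS.
rewrite mulrC -rs_expZ; apply: eq_rs_exp => B BD; rewrite gE //; congr (_ * _).
rewrite /contains; congr (nat_of_bool _)%:R; apply/subsetP/subsetP => sA x xS.
  have := sA x xS; rewrite inE => /orP[//|xB].
  by have /subsetP/(_ x xB) := BD; rewrite inE xS.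
by rewrite inE sA.
Qed.

Lemma rs_exp_disjoint S D : S \subset D ->
  rs_exp D (fun A => [disjoint S & A]%:R) = (1 - p) ^+ #|S|.
Proof.
move=> SD; rewrite -(setID D S) (setIidPr SD) rs_expU; last first.
  exact: disjoint_setDr.
have -> : (1 - p) ^+ #|S| = rs_exp S (fun A => [disjoint S & A]%:R).
  rewrite /rs_exp (bigD1 set0) ?sub0set //= big1 ?addr0 => [|A /andP[AS A0]]; last first.
    rewrite disjoint_sym -setI_eq0 (setIidPl AS) (negPf A0); exact: mulr0.
  rewrite -setI_eq0 setI0 eqxx mulr1 /rs_mass.
  by under eq_bigr do rewrite inE; rewrite prodr_const.
apply: eq_rs_exp => A AS.
rewrite -[RHS](rs_exp_cst (D :\: S)); apply: eq_rs_exp => B BD.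
congr (nat_of_bool _)%:R; rewrite -!setI_eq0 setIUr.
suff -> : S :&: B = set0 by rewrite setU0.
apply/setP => x; rewrite !inE; apply/andP => -[xS xB].
by have /subsetP/(_ x xB) := BD; rewrite inE xS.
Qed.

Definition avoids (K : Type) (S : K -> {set T}) (s : seq K) A : R :=
  (all (fun i => ~~ (S i \subset A)) s)%:R.

Lemma avoids_decreasing (K : Type) (S : K -> {set T}) s :
  increasing (fun A => - avoids S s A).
Proof.
move=> A B AB; rewrite lerN2 /avoids; apply: ler_bool.
by apply: sub_all => i; apply: contra => /subset_trans; apply.
Qed.

Lemma avoids_ge0 (K : Type) (S : K -> {set T}) s A : 0 <= avoids S s A.
Proof. exact: ler0n. Qed.

Lemma avoids_setD (K : eqType) (S : K -> {set T}) (X : {set T}) s :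
  (forall i, i \in s -> [disjoint X & S i]) ->
  forall A, avoids S s (A :\: X) = avoids S s A.
Proof.
move=> dis A; congr (nat_of_bool _)%:R; apply: eq_in_all => i iS; congr (~~ _).
by rewrite subsetD disjoint_sym dis // andbT.
Qed.

Lemma avoids_cons (K : Type) (S : K -> {set T}) i s A :
  avoids S (i :: s) A = avoids S s A - contains (S i) A * avoids S s A.
Proof.
rewrite /avoids /contains /=; case: (S i \subset A) => /=; first by rewrite mul1r subrr.
by rewrite mul0r subr0.
Qed.

(** A union bound over the constraints outside [P]. The factor [avoids S (filter P s)] stays inside
    the sum so that Harris' inequality can be applied to each term. *)
Lemma avoids_split (K : Type) (S : K -> {set T}) (P : pred K) s A :
  avoids S (filter P s) A - \sum_(j <- s | ~~ P j) contains (S j) A * avoids S (filter P s) A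
    <= avoids S s A.
Proof.
elim: s => [|i s IH]; first by rewrite big_nil subr0.
rewrite big_cons /=; case: (P i) => /=; last first.
  rewrite avoids_cons.
  have [h|h] : contains (S i) A = 0 \/ contains (S i) A = 1.
    by rewrite /contains; case: (_ \subset _); [right|left].
  - by rewrite h !mul0r add0r subr0.
  - rewrite h !mul1r subrr opprD addrA subrr sub0r oppr_le0.
    by apply: sumr_ge0 => j _; rewrite mulr_ge0 // ler0n.
rewrite !avoids_cons.
have [h|h] : contains (S i) A = 0 \/ contains (S i) A = 1.
  by rewrite /contains; case: (_ \subset _); [right|left].
  by rewrite h !mul0r !subr0.
rewrite h !mul1r !subrr sub0r oppr_le0.
by apply: sumr_ge0 => j _; rewrite mulr_ge0 // ler0n.
Qed.

Lemma contains_setU S1 S2 A : contains S1 A * contains S2 A = contains (S1 :|: S2) A.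
Proof. by rewrite /contains subUset -natrM mulnb. Qed.

(* One step of Janson's inequality: independence handles the [S j] disjoint
   from [S i], Harris' inequality the others. *)
Lemma janson_step (K : eqType) (S : K -> {set T}) D i s : S i \subset D ->
  \sum_(j <- s | ~~ [disjoint S i & S j]) p ^+ #|S i :|: S j| <= p ^+ #|S i| / 2 ->
  (forall j, j \in s -> S j \subset D) ->
  rs_exp D (avoids S (i :: s)) <= (1 - p ^+ #|S i| / 2) * rs_exp D (avoids S s).
Proof.
move=> SiD small SD.
pose P j := [disjoint S i & S j]; pose g := avoids S (filter P s).
under eq_rs_exp do rewrite avoids_cons.
rewrite rs_expB mulrBl mul1r lerD2l lerN2.
(* Both sides are compared with [rs_exp D g]: dropping constraints only increases the expectation on
   the left, and [g] does not depend on the elements of [S i]. *)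
have le_sg : rs_exp D (avoids S s) <= rs_exp D g.
  apply: ler_rs_exp => A _; rewrite /g /avoids; apply: ler_bool.
  by rewrite all_filter; apply: sub_all => j /= ->; rewrite implybT.
have g0 : 0 <= rs_exp D g.
  by rewrite -(rs_exp_cst D 0); apply: ler_rs_exp => A _; exact: avoids_ge0.
apply: (@le_trans _ _ (p ^+ #|S i| / 2 * rs_exp D g)).
  by apply: ler_wpM2l => //; rewrite divr_ge0 ?exprn_ge0.
apply: (@le_trans _ _ (rs_exp D (fun A => contains (S i) A * g A -
   \sum_(j <- s | ~~ P j) contains (S i :|: S j) A * g A))); last first.
  apply: ler_rs_exp => A _.
  apply: le_trans (ler_wpM2l (ler0n _ _) (avoids_split S P s A)).
  rewrite mulrBr lerD2l lerN2 big_distrr /= le_eqVlt; apply/orP; left; apply/eqP.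
  by apply: eq_bigr => j _; rewrite mulrA contains_setU.
rewrite rs_expB rs_exp_sum rs_exp_contains_indep //; last first.
  by apply: avoids_setD => j; rewrite mem_filter => /andP[].
apply: (@le_trans _ _ (p ^+ #|S i| * rs_exp D g -
   \sum_(j <- s | ~~ P j) p ^+ #|S i :|: S j| * rs_exp D g)); last first.
  rewrite lerD2l lerN2 big_seq_cond [leRHS]big_seq_cond.
  apply: ler_sum => j /andP[js Pj].
  have SijD : S i :|: S j \subset D by rewrite subUset SiD SD.
  have := @rs_exp_contains_indep _ D (fun=> 1) SijD (fun=> erefl).
  rewrite rs_exp_cst mulr1 => <-.
  under [X in _ <= X * _]eq_rs_exp do rewrite mulr1.
  by apply: harris; [exact: increasing_contains|exact: avoids_decreasing].
rewrite -big_distrl -mulrBl ler_wpM2r // lerBrDr -lerBrDl.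
by rewrite (le_trans small) // {2}(splitr (p ^+ _)) addrK.
Qed.

(** The overlap condition is imposed at each index separately, not on the total as in the usual
    form, and so it passes to every tail of [s]; each index then contributes one factor. *)
Lemma janson (K : eqType) (S : K -> {set T}) D k (s : seq K) : uniq s ->
  (forall i, i \in s -> S i \subset D) -> (forall i, i \in s -> #|S i| = k) ->
  (forall i, i \in s ->
    \sum_(j <- s | (j != i) && ~~ [disjoint S i & S j]) p ^+ #|S i :|: S j|
      <= p ^+ k / 2) ->
  rs_exp D (avoids S s) <= (1 - p ^+ k / 2) ^+ size s.
Proof.
have pk : 0 <= 1 - p ^+ k / 2.
  have := exprn_ile1 k p0 (proj2 (andP p01)).
  by move=> h; lra.
elim: s => [|i s IH] /=; first by move=> *; rewrite expr0 -[leRHS](rs_exp_cst D); apply: ler_rs_exp.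
case/andP=> iNs us SD Sk small.
have si : i \in i :: s by rewrite mem_head.
rewrite exprS; apply: (@le_trans _ _ ((1 - p ^+ k / 2) * rs_exp D (avoids S s))).
  rewrite -(Sk i si); apply: janson_step; first exact: SD.
  - rewrite Sk //; apply: le_trans (small i si).
    rewrite big_cons eqxx /= big_seq_cond [leRHS]big_seq_cond le_eqVlt; apply/orP; left.
    apply/eqP/eq_bigl => j; case js: (j \in s) => //=.
    by case: eqP => // ji; rewrite -ji js in iNs.
  - by move=> j js; rewrite SD // inE js orbT.
apply: ler_wpM2l => //; apply: IH => // j js; rewrite ?SD ?Sk ?inE ?js ?orbT //.
apply: le_trans (small j _); last by rewrite inE js orbT.
rewrite big_cons; case: ifP => // _.
by rewrite lerDr exprn_ge0.
Qed.

End RandomSubset.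

(** At one element the difference of the two sides is [(q - p) * (b' - b) + p * (b' - a') + (1 - p)
    * (b - a)], with all three terms nonnegative. *)
Lemma ler_rs_exp_p (R : realFieldType) (T : finType) (p q : R) (D : {set T})
    (f : {set T} -> R) : 0 <= p -> p <= q -> q <= 1 -> increasing f ->
  rs_exp p D f <= rs_exp q D f.
Proof.
move=> p0 pq q1.
have p01 : 0 <= p <= 1 by rewrite p0 (le_trans pq).
have q01 : 0 <= q <= 1 by rewrite q1 (le_trans p0).
move: f; elim/rs_exp_ind: D => [|e D eD IH] f fI; first by rewrite !rs_exp0.
rewrite !rs_expU1 //.
have := IH _ fI; have := IH _ (increasing_setU1 e fI).
have := ler_rs_exp_setU1 p01 e D fI; have := ler_rs_exp_setU1 q01 e D fI.
set a := rs_exp p D f; set b := rs_exp q D f.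
set a' := rs_exp p D (fun A => f (e |: A)); set b' := rs_exp q D (fun A => f (e |: A)) => bb aa ab' ab.
have h1 : 0 <= (q - p) * (b' - b) by rewrite mulr_ge0 // subr_ge0.
have h2 : 0 <= p * (b' - a') by rewrite mulr_ge0 // subr_ge0.
have h3 : 0 <= (1 - p) * (b - a) by rewrite mulr_ge0 // subr_ge0 // (le_trans pq).
lra.
Qed.

(** * Random permutations *)

Lemma sum_ge_card (R : numDomainType) (T : finType) (A B : {set T}) (F : T -> R) k m :
  B \subset A -> (forall x, 0 <= F x) -> 0 <= m -> (k <= #|B|)%N ->
  (forall x, x \in B -> m <= F x) -> k%:R * m <= \sum_(x in A) F x.
Proof.
move=> BA F0 m0 kB mF; rewrite -(setIidPr BA) in kB mF.
rewrite (big_setID B) /= -[leLHS]addr0; apply: lerD; last exact: sumr_ge0.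
apply: (@le_trans _ _ (\sum_(x in A :&: B) m)); last exact: ler_sum.
by rewrite sumr_const -[leRHS]mulr_natl ler_wpM2r // ler_nat.
Qed.

Section RandomPermutation.
Variables (R : realFieldType) (V : finType) (N1 N2 : {set V}).
Implicit Types (pi : {perm V}) (t : V * V * V) (T : seq (V * V * V)).

Definition hits pi t := [&& pi t.1.1 \in N1, pi t.2 \in N1 & pi (center t) \in N2].

(** This is [2^-1] to the power of the number of hit triples; its mean over [pi] controls the lower
    tail of that number. *)
Definition hit_weight pi T : R := \prod_(t <- T) (if hits pi t then 2^-1 else 1).

Lemma hit_weight_ge0 pi T : 0 <= hit_weight pi T.
Proof. by apply: prodr_ge0 => t _; case: ifP; rewrite ?invr_ge0. Qed.

(* The image of the first triple is resampled by three transpositions that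
   leave the other triples alone. *)
Lemma hit_weight_step (gam : R) g t T : uniq (flatten (map (@tseq V) (t :: T))) ->
  (g + 3 * size T + 2 <= #|N1|)%N -> (g + 3 * size T + 2 <= #|N2|)%N ->
  gam * (#|V| ^ 3)%:R <= (g ^ 3)%:R -> 0 <= gam ->
  \sum_pi hit_weight pi (t :: T) <= (1 - gam / 2) * \sum_pi hit_weight pi T.
Proof.
move=> uT gN1 gN2 gam_le gam0.
case: t uT => [[a c] b]; set t := (a, c, b) => uT.
pose S := \sum_pi hit_weight pi (t :: T).
pose P := [set z in flatten (map (@tseq V) T)]; pose V' := ~: P.
have cardP : #|P| = (3 * size T)%N.
  have uT' : uniq (flatten (map (@tseq V) T)).
    by move: uT; rewrite /= => /and4P[].
  rewrite cardsE (card_uniqP uT') size_flatten /shape -map_comp.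
  by elim: (T) => //= x l ->; lia.
have /and4P[] : [&& a \notin [:: c, b & flatten (map (@tseq V) T)],
    c \notin b :: flatten (map (@tseq V) T), b \notin flatten (map (@tseq V) T)
    & uniq (flatten (map (@tseq V) T))] := uT.
rewrite !inE !negb_or => /and3P[ac ab aT] /andP[cb cT] bT _.
have [aV' cV' bV'] : [/\ a \in V', c \in V' & b \in V'] by rewrite !inE.
pose kap x y w : {perm V} := (tperm a x * tperm c y * tperm b w)%g.
have kapN x y w z : x \in V' -> y \in V' -> w \in V' -> z \in P -> kap x y w z = z.
  move=> xV yV wV zP; have N u : u \in V' -> u != z.
    by move=> uV; apply: contraTneq uV => ->; rewrite inE zP.
  by rewrite !permM !tpermD ?N.
(* Multiplication by [kap x y w] permutes the permutations, so this holds for each choice of [x],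
   [y], [w]. Averaging over the choices resamples the image of [t]. *)
have Seq x y w : x \in V' -> y \in V' -> w \in V' ->
    S = \sum_pi hit_weight pi T * (1 - (hits (kap x y w * pi)%g t)%:R / 2).
  move=> xV yV wV; rewrite /S (reindex_inj (mulgI (kap x y w))) /=.
  apply: eq_bigr => pi _; rewrite /hit_weight big_cons mulrC; congr (_ * _).
    have kE z : (kap x y w * pi)%g z = pi (kap x y w z) by exact: permM.
    apply: eq_big_seq => t' t'T; have PP z : z \in tseq t' -> z \in P.
      by move=> zt; rewrite inE; apply/flattenP; exists (tseq t'); rewrite ?map_f.
    by rewrite /hits !kE !kapN // PP // !inE eqxx ?orbT.
  by case: (hits _ t); rewrite ?mul0r ?subr0 // mul1r; lra.
pose v := #|V'|%:R : R.
have v0 : 0 < v by rewrite ltr0n; apply/card_gt0P; exists a.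
have Ssum : v * (v * (v * S)) = \sum_(x in V') \sum_(y in V') \sum_(w in V')
    \sum_pi hit_weight pi T * (1 - (hits (kap x y w * pi)%g t)%:R / 2).
  under eq_bigr => x xV do under eq_bigr => y yV do
    under eq_bigr => w wV do rewrite -(Seq x y w xV yV wV).
  by rewrite !sumr_const /v !mulr_natl.
(* The other triples exclude [3 * size T] vertices. Two more are excluded so that the transpositions
   do not interfere and [kap] really sends [a], [c], [b] to [x], [y], [w]; hence the [+ 2] in the
   hypotheses. *)
have cardA (N : {set V}) pi (u1 u2 : V) : (g + 3 * size T + 2 <= #|N|)%N ->
    (g <= #|((pi @^-1: N) :&: V') :\: [set u1; u2]|)%N.
  move=> gN.
  have e1 : #|pi @^-1: N| = #|N|.
    by rewrite -[pi]invgK preim_permV card_imset //; exact: perm_inj.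
  have e2 : (#|[set u1; u2]| <= 2)%N by rewrite cards2; case: (_ != _).
  rewrite cardsD.
  have e3 := subset_leq_card (subsetIr (pi @^-1: N :&: V') [set u1; u2]).
  have e4 : (#|pi @^-1: N| - 3 * size T <= #|pi @^-1: N :&: V'|)%N.
    rewrite /V' -setDE cardsD -cardP leq_sub2l // subset_leq_card //.
    exact: subsetIr.
  rewrite e1 in e4; clear - gN e2 e3 e4; lia.
have succ pi : (g ^ 3)%:R <= \sum_(x in V') \sum_(y in V') \sum_(w in V')
    (hits (kap x y w * pi)%g t)%:R :> R.
  rewrite !expnS expn0 muln1 !natrM.
  apply: (@sum_ge_card _ _ _ (((pi @^-1: N1) :&: V') :\: [set c; b])).
  - exact: subset_trans (subsetDl _ _) (subsetIr _ _).
  - by move=> x; do 2! apply: sumr_ge0 => ? _.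
  - by rewrite mulr_ge0.
  - exact: cardA.
  move=> x; rewrite !inE negb_or => /andP[/andP[xc xb] /andP[xN1 _]].
  apply: (@sum_ge_card _ _ _ (((pi @^-1: N2) :&: V') :\: [set b; x])).
  - exact: subset_trans (subsetDl _ _) (subsetIr _ _).
  - by move=> y; apply: sumr_ge0 => ? _.
  - by [].
  - exact: cardA.
  move=> y; rewrite !inE negb_or => /andP[/andP[yb yx] /andP[yN2 _]].
  rewrite -[leLHS]mulr1.
  apply: (@sum_ge_card _ _ _ (((pi @^-1: N1) :&: V') :\: [set x; y])) => //.
  - exact: subset_trans (subsetDl _ _) (subsetIr _ _).
  - exact: cardA.
  move=> w; rewrite !inE negb_or => /andP[/andP[wx wy] /andP[wN1 _]].
  have -> : hits (kap x y w * pi)%g t = true; last by [].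
  rewrite /hits /center /= !permM tpermL.
  rewrite [tperm c y x]tpermD 1?[c == x]eq_sym // ?[tperm b w x]tpermD 1?[b == x]eq_sym //.
  rewrite xN1 [tperm a x b]tpermD // [tperm c y b]tpermD // tpermL wN1.
  by rewrite [tperm a x c]tpermD // tpermL [tperm b w y]tpermD // 1?eq_sym.
have vV : v ^+ 3 <= (#|V| ^ 3)%:R.
  by rewrite -natrX ler_nat leq_exp2r // max_card.
have : v ^+ 3 * S <= v ^+ 3 * ((1 - gam / 2) * \sum_pi hit_weight pi T); last first.
  by rewrite ler_pM2l // exprn_gt0.
rewrite !exprS expr0 mulr1 -!mulrA Ssum.
under eq_bigr => x _ do under eq_bigr => y _ do rewrite exchange_big /=.
under eq_bigr => x _ do rewrite exchange_big /=.
rewrite exchange_big /= !big_distrr /=; apply: ler_sum => pi _.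
under eq_bigr => x _ do under eq_bigr => y _ do rewrite -big_distrr /=.
under eq_bigr => x _ do rewrite -big_distrr /=.
rewrite -big_distrr /= [leRHS](_ : _ = hit_weight pi T * (v ^+ 3 * (1 - gam / 2))); last by ring.
apply: ler_wpM2l; first exact: hit_weight_ge0.
rewrite (_ : \sum_(x in V') _ = v ^+ 3 - (\sum_(x in V') \sum_(y in V') \sum_(w in V')
    (hits (kap x y w * pi)%g t)%:R) / 2); last first.
  rewrite !big_distrl /= (_ : v ^+ 3 = \sum_(x in V') \sum_(y in V') \sum_(w in V') 1).
    rewrite -sumrB; apply: eq_bigr => x _; rewrite big_distrl /= -sumrB.
    by apply: eq_bigr => y _; rewrite big_distrl /= -sumrB.
  by rewrite !sumr_const -!mulrnA -natrX !expnS expn0 muln1.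
have := succ pi; set s := \sum_(x in V') _ => gs.
have : v ^+ 3 * gam <= (#|V| ^ 3)%:R * gam by rewrite ler_wpM2r.
lra.
Qed.

Lemma hit_weight_sum (gam : R) g T : uniq (flatten (map (@tseq V) T)) ->
  (g + 3 * size T <= #|N1|)%N -> (g + 3 * size T <= #|N2|)%N ->
  gam * (#|V| ^ 3)%:R <= (g ^ 3)%:R -> 0 <= gam <= 1 ->
  \sum_pi hit_weight pi T <= (1 - gam / 2) ^+ size T * #|{perm V}|%:R.
Proof.
move=> + + + gam_le /andP[gam0 gam1]; elim: T => [|t T IH] uT gN1 gN2.
  rewrite expr0 mul1r; under eq_bigr do rewrite /hit_weight big_nil.
  by rewrite sumr_const.
rewrite /= in gN1 gN2.
have := hit_weight_step uT _ _ gam_le gam0; move=> /(_ _ _)/le_trans; apply; [lia|lia|].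
rewrite exprS -mulrA ler_wpM2l ?IH //; [lra| |lia|lia].
by move: uT; rewrite /= => /and4P[].
Qed.

(** Markov's inequality for [hit_weight], which exceeds [2^-1 ^+ k] when there are fewer than [k]
    hits. *)
Lemma few_hits (gam : R) g k T : uniq (flatten (map (@tseq V) T)) ->
  (g + 3 * size T <= #|N1|)%N -> (g + 3 * size T <= #|N2|)%N ->
  gam * (#|V| ^ 3)%:R <= (g ^ 3)%:R -> 0 <= gam <= 1 ->
  #|[set pi | (count (hits pi) T < k)%N]|%:R <=
    2 ^+ k * (1 - gam / 2) ^+ size T * #|{perm V}|%:R.
Proof.
move=> uT gN1 gN2 gam_le gam01.
have H := hit_weight_sum uT gN1 gN2 gam_le gam01.
have WE pi : hit_weight pi T = 2^-1 ^+ count (hits pi) T.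
  rewrite /hit_weight; elim: (T) => [|t l IH]; first by rewrite big_nil.
  by rewrite big_cons IH /=; case: ifP => _; rewrite ?mul1r // exprS.
rewrite -mulrA -ler_pdivrMl ?exprn_gt0 //; apply: le_trans H.
rewrite (bigID (fun pi => (count (hits pi) T < k)%N)) /= -[leLHS]addr0.
apply: lerD; last by apply: sumr_ge0 => pi _; exact: hit_weight_ge0.
have -> : #|[set pi | (count (hits pi) T < k)%N]|%:R =
    \sum_(pi | (count (hits pi) T < k)%N) 1 :> R.
  by rewrite -sum1_card natr_sum; apply: eq_bigl => pi; rewrite inE.
rewrite big_distrr /=.
apply: ler_sum => pi ck; rewrite mulr1 WE -exprVn.
by apply: ler_wiXn2l; [lra|lra|exact: ltnW].
Qed.

End RandomPermutation.

(** * Expansion and short cycles in the random graph *)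

Lemma in_set3U (T : finType) (a b c d e : T) :
  [/\ [set a; b; c] :|: [set a; d; e] =i [:: a; b; c; d; e],
      [set a; b; c] :|: [set d; b; e] =i [:: a; b; c; d; e]
    & [set a; b; c] :|: [set d; e; c] =i [:: a; b; c; d; e]].
Proof.
by split=> z; rewrite !inE; move: (z == a) (z == b) (z == c) (z == d) (z == e);
  do 5! case.
Qed.

(* Janson's inequality for configurations of three elements, any two of which
   determine the configuration. *)
Lemma janson_triples (R : realFieldType) (K T : finType) (f1 f2 f3 : K -> T)
    (I : {set K}) (D : {set T}) (p : R) (M : nat) : 0 <= p <= 1 ->
  {in I &, forall i j, [/\ f1 i != f2 j, f1 i != f3 j & f2 i != f3 j]} ->
  {in I &, forall i j, [|| (f1 i == f1 j) && (f2 i == f2 j),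
     (f1 i == f1 j) && (f3 i == f3 j) | (f2 i == f2 j) && (f3 i == f3 j)] -> i = j} ->
  {in I, forall i, [/\ f1 i \in D, f2 i \in D & f3 i \in D]} ->
  {in I, forall i, (#|[set j in I | f1 j == f1 i]| + #|[set j in I | f2 j == f2 i]|
     + #|[set j in I | f3 j == f3 i]| <= M)%N} ->
  p ^+ 2 * M%:R <= 2^-1 ->
  rs_exp p D (avoids R (fun i => [set f1 i; f2 i; f3 i]) (enum I))
    <= (1 - p ^+ 3 / 2) ^+ #|I|.
Proof.
move=> p01 cross det fD cM pM; have p0 : 0 <= p by case/andP: p01.
have p1 : p <= 1 by case/andP: p01.
rewrite [in leRHS]cardE; apply: janson => //; first exact: enum_uniq.
- move=> i; rewrite mem_enum => iI; have [d1 d2 d3] := fD i iI.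
  by rewrite !subUset !sub1set d1 d2 d3.
- move=> i; rewrite mem_enum => iI; have [n12 n13 n23] := cross i i iI iI.
  rewrite (_ : [set _; _; _] = [set z in [:: f1 i; f2 i; f3 i]]); last first.
    by apply/setP => z; rewrite !inE orbA.
  rewrite cardsE (card_uniqP _) //= !inE negb_or n12 n13 n23; by [].
move=> i; rewrite mem_enum => iI; rewrite big_enum_cond /=.
pose B := [set j in I | f1 j == f1 i] :|: [set j in I | f2 j == f2 i]
  :|: [set j in I | f3 j == f3 i].
(* Distinct configurations that meet share exactly one element, in the same of the three roles, so
   their union has five elements. At most [M] configurations meet a given one, and the overlap sum
   is at most [M%:R * p ^+ 5]. *)
apply: (@le_trans _ _ (\sum_(j in B) p ^+ 5)); last first.
  rewrite sumr_const -[leLHS]mulr_natl.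
  have BM : #|B|%:R <= M%:R :> R.
    rewrite ler_nat; apply: leq_trans (cM i iI).
    apply: leq_trans (leq_card_setU _ _).1 _.
    by rewrite leq_add2r (leq_card_setU _ _).1.
  apply: (@le_trans _ _ (M%:R * p ^+ 5)); first by rewrite ler_wpM2r ?exprn_ge0.
  have : p ^+ 3 * (p ^+ 2 * M%:R) <= p ^+ 3 * 2^-1 by rewrite ler_wpM2l ?exprn_ge0.
  by rewrite mulrA -exprD mulrC.
apply: (@le_trans _ _ (\sum_(j in I | (j != i) &&
    ~~ [disjoint [set f1 i; f2 i; f3 i] & [set f1 j; f2 j; f3 j]]) p ^+ 5)).
  apply: ler_sum => j /andP[jI /andP[ji ndis]].
  apply: ler_wiXn2l => //.
  have [n12 n13 n23] := cross i i iI iI; have [m12 m13 m23] := cross j j jI jI.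
  have [k12 k13 k23] := cross i j iI jI; have [l12 l13 l23] := cross j i jI iI.
  have nd := det i j iI jI.
  have five a b c d e : uniq [:: a; b; c; d; e] ->
      [set f1 i; f2 i; f3 i] :|: [set f1 j; f2 j; f3 j] =i [:: a; b; c; d; e] ->
      (5 <= #|[set f1 i; f2 i; f3 i] :|: [set f1 j; f2 j; f3 j]|)%N.
    by move=> u5 E; rewrite (eq_card E) (card_uniqP u5).
  have [E1|N1] := eqVneq (f1 i) (f1 j).
    have N2 : f2 i != f2 j by apply: contraNneq ji => E; rewrite nd // E1 E !eqxx.
    have N3 : f3 i != f3 j by apply: contraNneq ji => E; rewrite nd // E1 E !eqxx orbT.
    apply: (five (f1 i) (f2 i) (f3 i) (f2 j) (f3 j)).
      by rewrite /= !inE !negb_or n12 n13 n23 k12 k13 N2 k23 N3 m23 eq_sym l23.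
    by rewrite -E1; case: (in_set3U (f1 i) (f2 i) (f3 i) (f2 j) (f3 j)).
  have [E2|N2] := eqVneq (f2 i) (f2 j).
    have N3 : f3 i != f3 j by apply: contraNneq ji => E; rewrite nd // E2 E !eqxx !orbT.
    apply: (five (f1 i) (f2 i) (f3 i) (f1 j) (f3 j)).
      by rewrite /= !inE !negb_or n12 n13 n23 N1 k13 k23 [f2 i == f1 j]eq_sym l12
        [f3 i == f1 j]eq_sym l13 N3 m13.
    by rewrite -E2; case: (in_set3U (f1 i) (f2 i) (f3 i) (f1 j) (f3 j)).
  have [E3|N3] := eqVneq (f3 i) (f3 j).
    apply: (five (f1 i) (f2 i) (f3 i) (f1 j) (f2 j)).
      by rewrite /= !inE !negb_or n12 n13 n23 N1 k12 [f2 i == f1 j]eq_sym l12 N2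
        [f3 i == f1 j]eq_sym l13 [f3 i == f2 j]eq_sym l23 m12.
    by rewrite -E3; case: (in_set3U (f1 i) (f2 i) (f3 i) (f1 j) (f2 j)).
  case/negP: ndis; rewrite -setI_eq0; apply/eqP/setP => z; rewrite !inE.
  apply/negbTE/negP => /andP[/orP[/orP[]|] /eqP -> /orP[/orP[]|]] //;
    by rewrite ?(negPf N1) ?(negPf N2) ?(negPf N3) ?(negPf k12) ?(negPf k13) ?(negPf k23)
      // eq_sym ?(negPf l12) ?(negPf l13) ?(negPf l23).
rewrite [leLHS]big_mkcond [leRHS]big_mkcond; apply: ler_sum => j _.
case: ifP => [/andP[jI /andP[ji ndis]]|_]; last by case: ifP => // _; rewrite exprn_ge0.
suff -> : j \in B by [].
apply: contraNT ndis; rewrite !inE jI /= !negb_or => /andP[/andP[N1 N2] N3].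
have [k12 k13 k23] := cross i j iI jI; have [l12 l13 l23] := cross j i jI iI.
rewrite -setI_eq0; apply/eqP/setP => z; rewrite !inE.
apply/negbTE/negP => /andP[/orP[/orP[]|] /eqP -> /orP[/orP[]|]] //;
  by rewrite ?(negPf k12) ?(negPf k13) ?(negPf k23)
    // eq_sym ?(negPf l12) ?(negPf l13) ?(negPf l23) ?(negPf N1) ?(negPf N2) ?(negPf N3).
Qed.

Section Indicators.
Variables (R : realFieldType) (p : R).
Hypothesis p01 : 0 <= p <= 1.

Definition rs_pr (T : finType) (D : {set T}) (P : {set T} -> Prop) : R :=
  rs_exp p D (fun A => (`[< P A >])%:R).

Lemma rs_pr_ge0 (T : finType) (D : {set T}) P : 0 <= rs_pr D P.
Proof. by rewrite -(rs_exp_cst p D 0); apply: ler_rs_exp => // A _; rewrite ler0n. Qed.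

Lemma ler_rs_pr (T : finType) (D : {set T}) (P Q : {set T} -> Prop) :
  (forall A : {set T}, A \subset D -> P A -> Q A) -> rs_pr D P <= rs_pr D Q.
Proof.
move=> PQ; apply: ler_rs_exp => // A AD; apply: ler_bool => /asboolP PA.
by apply/asboolP; exact: PQ.
Qed.

Lemma rs_prU (T : finType) (D : {set T}) (P Q : {set T} -> Prop) :
  rs_pr D (fun A => P A \/ Q A) <= rs_pr D P + rs_pr D Q.
Proof.
rewrite -rs_expD; apply: ler_rs_exp => // A _; rewrite asbool_or.
by case: (`[< P A >]) => /=; rewrite ?add0r // lerDl ler0n.
Qed.

Lemma rs_pr_bigU (T K : finType) (D : {set T}) (I : pred K) (P : {set T} -> Prop)
    (Q : K -> {set T} -> Prop) :
  (forall A : {set T}, A \subset D -> P A -> exists2 i, I i & Q i A) ->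
  rs_pr D P <= \sum_(i | I i) rs_pr D (Q i).
Proof.
move=> PQ; rewrite -rs_exp_sum; apply: ler_rs_exp => // A AD.
case: asboolP => [/PQ[//|i Ii /asboolP QA]|_]; last by apply: sumr_ge0 => i _; rewrite ler0n.
by rewrite (bigD1 i) //= QA lerDl; apply: sumr_ge0 => j _; rewrite ler0n.
Qed.

End Indicators.

Section Expansion.
Variables (R : realFieldType) (V : finType) (p : R).
Hypothesis p01 : 0 <= p <= 1.

(** A union bound over at most [4 ^+ #|V|] pairs of sets, each of which would have to miss at least
    [s ^ 2] possible edges. *)
Lemma not_joined_prob s :
  rs_pr p (pairs V) (fun A => ~ joined (eadj A) s) <= 4 ^+ #|V| * (1 - p) ^+ (s ^ 2).
Proof.
have p0 : 0 <= p by case/andP: p01.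
have p1 : p <= 1 by case/andP: p01.
have q0 : 0 <= 1 - p by rewrite subr_ge0.
pose I (XY : {set V} * {set V}) :=
  [&& [disjoint XY.1 & XY.2], (s <= #|XY.1|)%N & (s <= #|XY.2|)%N].
pose f (z : V * V) := [set z.1; z.2].
pose Q (XY : {set V} * {set V}) := f @: setX XY.1 XY.2.
apply: le_trans (@rs_pr_bigU _ _ p01 _ _ _ I _ (fun XY A => [disjoint Q XY & A]) _) _.
  move=> A _ /existsNP[X /existsNP[Y /not_implyP[dXY /not_implyP[sX /not_implyP[sY nE]]]]].
  exists (X, Y); first by rewrite /I dXY sX sY.
  rewrite -setI_eq0; apply/eqP/setP => z; rewrite !inE; apply/negbTE/negP.
  case/andP => /imsetP[[x y] /setXP[/= xX yY] ->] xyA.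
  by apply: nE; exists x, y.
apply: (@le_trans _ _ (\sum_(XY | I XY) (1 - p) ^+ (s ^ 2))).
  apply: ler_sum => -[X Y] /and3P[/= dXY sX sY].
  rewrite /rs_pr; under eq_rs_exp => A _ do rewrite asboolb.
  rewrite rs_exp_disjoint //; last first.
    apply/subsetP => z /imsetP[[x y] /setXP[/= xX yY] ->]; rewrite pairs2 /=.
    by apply: contraTneq yY => <-; rewrite (disjointFr dXY).
  apply: ler_wiXn2l; rewrite ?gerBl //.
  rewrite card_in_imset ?cardsX ?leq_mul //.
  move=> [x y] [x' y'] /setXP[/= xX yY] /setXP[/= xX' yY'] E.
  have [/=|/= -> ->] // := set2_inj E.
  by apply: contraTneq yY' => <-; rewrite (disjointFr dXY).
rewrite sumr_const -[leLHS]mulr_natl ler_wpM2r ?exprn_ge0 //.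
apply: (@le_trans _ _ (#|{: {set V} * {set V}}|%:R)); first by rewrite ler_nat max_card.
rewrite card_prod -[#|{set V}|]cardsT -powersetT card_powerset cardsT -expnMn.
by rewrite natrX.
Qed.

(** [js] stands for the pairs of ends of disjoint paths in [U]. The three edges of a configuration
    fix [(j, x)], [(x, y)] and [(j, y)] respectively, so any two determine it, and one edge leaves
    at most [#|Y|], [size js] or [#|X|] choices. The two ends of a path may coincide, which is the
    case of triangles. *)
Lemma no_closing_prob (U X Y : {set V}) (D : {set {set V}}) (js : seq (V * V)) :
  [disjoint U & X] -> [disjoint U & Y] -> [disjoint X & Y] ->
  uniq (unzip1 js) -> uniq (unzip2 js) -> {subset unzip1 js <= U} ->
  {subset unzip2 js <= U} ->
  (forall u v, u != v -> ~~ ([set u; v] \subset U) -> [set u; v] \in D) ->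
  p ^+ 2 * (size js + #|X| + #|Y|)%:R <= 2^-1 ->
  rs_pr p D (fun A => ~ exists j x y, [/\ j \in js, x \in X & y \in Y] /\
     [/\ eadj A x j.1, eadj A x y & eadj A y j.2]) <=
  (1 - p ^+ 3 / 2) ^+ (size js * (#|X| * #|Y|)).
Proof.
move=> dUX dUY dXY u1 u2 s1 s2 HD pM.
pose I := setX [set j in js] (setX X Y).
pose f1 (i : (V * V) * (V * V)) := [set i.2.1; i.1.1].
pose f2 (i : (V * V) * (V * V)) := [set i.2.1; i.2.2].
pose f3 (i : (V * V) * (V * V)) := [set i.2.2; i.1.2].
have ujs : uniq js by apply: map_uniq u1.
have IP i : i \in I -> [/\ i.1 \in js, i.2.1 \in X & i.2.2 \in Y].
  by case: i => j [x y] /setXP[]; rewrite inE => /= jj /setXP[].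
have cI : #|I| = (size js * (#|X| * #|Y|))%N.
  by rewrite !cardsX cardsE (card_uniqP ujs).
have nXY x y : x \in X -> y \in Y -> x != y.
  by move=> xX yY; apply: contraTneq yY => <-; rewrite (disjointFr dXY).
have nXU x u : x \in X -> u \in U -> x != u.
  by move=> xX uU; apply: contraTneq xX => ->; rewrite (disjointFr dUX).
have nYU y u : y \in Y -> u \in U -> y != u.
  by move=> yY uU; apply: contraTneq yY => ->; rewrite (disjointFr dUY).
have j1 j : j \in js -> j.1 \in U by move=> jj; apply: s1; exact: map_f.
have j2 j : j \in js -> j.2 \in U by move=> jj; apply: s2; exact: map_f.
have i1 j j' : j \in js -> j' \in js -> j.1 = j'.1 -> j = j'.
  move=> jj jj' E; move: u1 => /(uniqP j.1) H.
  have := H (index j js) (index j' js); rewrite !inE size_map !index_mem jj jj'.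
  rewrite !(nth_map j) ?index_mem // !nth_index // => /(_ isT isT E) E'.
  by rewrite -(nth_index j jj) E' nth_index.
have i2 j j' : j \in js -> j' \in js -> j.2 = j'.2 -> j = j'.
  move=> jj jj' E; move: u2 => /(uniqP j.1) H.
  have := H (index j js) (index j' js); rewrite !inE size_map !index_mem jj jj'.
  rewrite !(nth_map j) ?index_mem // !nth_index // => /(_ isT isT E) E'.
  by rewrite -(nth_index j jj) E' nth_index.
have e1 i j : i \in I -> j \in I -> f1 i = f1 j -> i.1 = j.1 /\ i.2.1 = j.2.1.
  move=> /IP[ij iX iY] /IP[jj jX jY] /set2_inj[|Ex Ej]; first by rewrite nXU // j1.
  by split=> //; exact: i1.
have e2 i j : i \in I -> j \in I -> f2 i = f2 j -> i.2 = j.2.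
  move=> /IP[ij iX iY] /IP[jj jX jY] /set2_inj[|Ex Ey]; first by rewrite nXY.
  by rewrite [i.2]surjective_pairing Ex Ey -surjective_pairing.
have e3 i j : i \in I -> j \in I -> f3 i = f3 j -> i.1 = j.1 /\ i.2.2 = j.2.2.
  move=> /IP[ij iX iY] /IP[jj jX jY] /set2_inj[|Ex Ej]; first by rewrite nYU // j2.
  by split=> //; exact: i2.
have eI (i j : (V * V) * (V * V)) : i.1 = j.1 -> i.2.1 = j.2.1 -> i.2.2 = j.2.2 -> i = j.
  by case: i j => [a [b c]] [d [e f]] /= -> -> ->.
rewrite -cI; apply: le_trans (@janson_triples _ _ _ f1 f2 f3 I D p _ p01 _ _ _ _ pM).
- apply: ler_rs_exp => // A _; apply: ler_bool => /asboolP nE.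
  apply/allP => -[j [x y]]; rewrite mem_enum => /IP[/= jj xX yY].
  apply/negP; rewrite !subUset !sub1set => /andP[/andP[h1 h2] h3].
  by apply: nE; exists j, x, y.
- move=> i j /IP[ij iX iY] /IP[jj jX jY]; split; apply/eqP.
  + by move=> /setP/(_ i.1.1); rewrite !inE eqxx orbT ![i.1.1 == _]eq_sym
      (negPf (nXU _ _ jX (j1 _ ij))) (negPf (nYU _ _ jY (j1 _ ij))).
  + by move=> /setP/(_ i.2.1); rewrite !inE eqxx (negPf (nXY _ _ iX jY))
      (negPf (nXU _ _ iX (j2 _ jj))).
  + by move=> /setP/(_ i.2.1); rewrite !inE eqxx (negPf (nXY _ _ iX jY))
      (negPf (nXU _ _ iX (j2 _ jj))).
- move=> i j iI jI /or3P[] /andP[/eqP E1 /eqP E2].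
  + have [Ej Ex] := e1 i j iI jI E1; have E := e2 i j iI jI E2.
    by apply: eI => //; rewrite E.
  + have [Ej Ex] := e1 i j iI jI E1; have [_ Ey] := e3 i j iI jI E2.
    exact: eI.
  + have E := e2 i j iI jI E1; have [Ej _] := e3 i j iI jI E2.
    by apply: eI; rewrite ?E.
- have nS z u : z \notin U -> ~~ ([set z; u] \subset U).
    by move=> zU; rewrite subUset sub1set negb_and zU.
  have XU x : x \in X -> x \notin U by move=> xX; rewrite (disjointFl dUX).
  have YU y : y \in Y -> y \notin U by move=> yY; rewrite (disjointFl dUY).
  move=> i /IP[ij iX iY]; split; apply: HD.
  + exact: nXU (j1 _ ij).
  + exact/nS/XU.
  + exact: nXY.
  + exact/nS/XU.
  + exact: nYU (j2 _ ij).
  + exact/nS/YU.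
- move=> i iI; have [ij iX iY] := IP i iI.
  have c1 : (#|[set j in I | f1 j == f1 i]| <= #|Y|)%N.
    rewrite -(card_in_imset (f := fun j : (V * V) * (V * V) => j.2.2)).
      apply/subset_leq_card/subsetP => z /imsetP[j]; rewrite inE => /andP[/IP[_ _ jY] _] ->.
      exact: jY.
    move=> j k; rewrite inE => /andP[jI /eqP Ej]; rewrite inE => /andP[kI /eqP Ek] E.
    have [a b] := e1 j i jI iI Ej; have [c d] := e1 k i kI iI Ek.
    by apply: eI; rewrite ?a ?b ?c ?d.
  have c2 : (#|[set j in I | f2 j == f2 i]| <= size js)%N.
    rewrite -(card_in_imset (f := fun j : (V * V) * (V * V) => j.1)).
      rewrite -(card_uniqP ujs); apply/subset_leq_card/subsetP => z.
      by move=> /imsetP[j]; rewrite inE => /andP[/IP[jj _ _] _] ->.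
    move=> j k; rewrite inE => /andP[jI /eqP Ej]; rewrite inE => /andP[kI /eqP Ek] E.
    have a := e2 j i jI iI Ej; have c := e2 k i kI iI Ek.
    by apply: eI; rewrite ?a ?c.
  have c3 : (#|[set j in I | f3 j == f3 i]| <= #|X|)%N.
    rewrite -(card_in_imset (f := fun j : (V * V) * (V * V) => j.2.1)).
      apply/subset_leq_card/subsetP => z /imsetP[j]; rewrite inE => /andP[/IP[_ jX _] _] ->.
      exact: jX.
    move=> j k; rewrite inE => /andP[jI /eqP Ej]; rewrite inE => /andP[kI /eqP Ek] E.
    have [a b] := e3 j i jI iI Ej; have [c d] := e3 k i kI iI Ek.
    by apply: eI; rewrite ?a ?b ?c ?d.
  apply: leq_trans (leq_add (leq_add c1 c2) c3) _.
  by rewrite -addnA addnC.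
Qed.

End Expansion.

Section ShortCycles.
Variables (R : realFieldType) (V : finType) (p : R).
Hypothesis p01 : 0 <= p <= 1.

(* The edges inside [U] are exposed first: they contain disjoint paths on
   [k.+1] vertices, which the remaining edges close to a cycle. *)
Lemma no_cycle_prob s k m (U X Y : {set V}) :
  [disjoint U & X] -> [disjoint U & Y] -> [disjoint X & Y] -> (0 < s)%N ->
  (m * k.+1 + k.+1 * (2 * s) <= #|U|)%N ->
  p ^+ 2 * (m + #|X| + #|Y|)%:R <= 2^-1 ->
  rs_pr p (pairs V) (fun A => joined (eadj A) s /\ ~ has_cycle A (U :|: X :|: Y) k.+3)
    <= (1 - p ^+ 3 / 2) ^+ (m * (#|X| * #|Y|)).
Proof.
move=> dUX dUY dXY s0 mU pM.
pose D1 := [set e in pairs V | e \subset U]; pose D2 := pairs V :\: D1.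
have D1V : D1 \subset pairs V by apply/subsetP => e; rewrite inE => /andP[].
have EV : pairs V = D1 :|: D2 by rewrite /D2 -{1}(setIidPr D1V) setID.
have [p0 p1] : 0 <= p /\ p <= 1 by apply/andP.
rewrite /rs_pr {1}EV rs_expU ?disjoint_setDr //.
set C := (_ ^+ _); rewrite -[C](rs_exp_cst p D1); apply: ler_rs_exp => // A AD1.
have C0 : 0 <= C.
  have := exprn_ile1 3 p0 p1; have := exprn_ge0 3 p0 => h1 h2.
  by rewrite exprn_ge0 //; lra.
(* If [A] contains no such paths, then [joined] fails for every [B], because all edges inside [U]
   come from [A]. *)
have [[cs [szs ucs pcs csU]]|nocs] := pselect (exists cs, [/\ map size cs = nseq m k.+1,
   uniq (flatten cs), all (sorted (eadj A)) cs & {subset flatten cs <= U}]); last first.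
  rewrite -(rs_exp_cst p D2 0) in C0; apply: le_trans C0.
  apply: ler_rs_exp => // B BD2; case: asboolP => // -[jAB _]; case: nocs.
  have paths l (W : {set V}) : l \in nseq m k.+1 -> (k.+1 * (2 * s) <= #|W|)%N ->
      exists c, [/\ size c = l, uniq c, sorted (eadj (A :|: B)) c & {subset c <= W}].
    rewrite mem_nseq => /andP[_ /eqP ->] Ws.
    by have [c [c1 c2 c3 c4]] := joined_path s0 jAB Ws; exists c.
  have [|cs [h1 h2 h3 h4]] := greedy_packing paths (U := U).
    by rewrite sumn_nseq mulnC.
  exists cs; split=> //; apply/allP => c cc.
  have cU : {subset c <= U} by move=> x xc; apply: h4; apply/flattenP; exists c.
  have := allP h3 c cc; apply: (@sub_in_sorted _ (mem U)); last by apply/allP.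
  move=> x y xU yU; rewrite /eadj inE => /orP[//|/(subsetP BD2)].
  by rewrite !inE subUset !sub1set [x \in U]xU [y \in U]yU andbT; case: (_ == 2).
have [V0|[x0 _]] := set_0Vmem [set: V].
  have := max_card (mem U); rewrite -cardsT V0 cards0 leqn0 => /eqP U0.
  by move: mU s0; rewrite U0 leqn0 addn_eq0 => /andP[_]; rewrite !muln_eq0 /= => /eqP ->.
have ck c : c \in cs -> size c = k.+1.
  move=> cc; have : size c \in map size cs by exact: map_f.
  by rewrite szs mem_nseq => /andP[_ /eqP].
pose js := [seq (head x0 c, last x0 c) | c <- cs].
have szjs : size js = m by rewrite size_map -(size_map size) szs size_nseq.
have headc c : c \in cs -> head x0 c \in c.
  by move=> /ck; case: c => //= x c _; rewrite mem_head.
have lastc c : c \in cs -> last x0 c \in c.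
  by move=> /ck; case: c => //= x c _; rewrite mem_last.
have inU c x : c \in cs -> x \in c -> x \in U.
  by move=> cc xc; apply: csU; apply/flattenP; exists c.
have ucs0 : uniq cs.
  move: ucs ck; clear; elim: cs => //= c cs IH; rewrite cat_uniq => /and3P[_ /hasPn h u] ck.
  rewrite IH // => [|d dd]; last by apply: ck; rewrite inE dd orbT.
  rewrite andbT; apply/negP => cc; have := ck c; rewrite mem_head => /(_ isT).
  case: c cc {ck} h => // x c cc h _; have := h x; rewrite mem_head => /(_ _)/negP; apply=> //.
  by apply/flattenP; exists (x :: c); rewrite ?mem_head.
have uproj (f : seq V -> V) : (forall c, c \in cs -> f c \in c) -> uniq (map f cs).
  move=> fc; rewrite map_inj_in_uniq // => c d cc dd E.
  by apply: (uniq_flatten_inj ucs cc dd (fc c cc)); rewrite E; exact: fc.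
have H := @no_closing_prob _ _ _ p01 U X Y D2 js dUX dUY dXY.
rewrite szjs in H; apply: le_trans (H _ _ _ _ _ pM); first last.
- move=> u v uv nUV; rewrite /D2 !inE (negPf nUV) andbF /=.
  by have := pairs2 u v; rewrite inE uv.
- move=> x; rewrite /unzip2 -map_comp => /mapP[c cc ->]; exact: inU cc (lastc c cc).
- move=> x; rewrite /unzip1 -map_comp => /mapP[c cc ->]; exact: inU cc (headc c cc).
- by rewrite /unzip2 -map_comp; exact: uproj.
- by rewrite /unzip1 -map_comp; exact: uproj.
apply: ler_rs_exp => // B BD2; apply: ler_bool => /asboolP[jAB nC]; apply/asboolP.
case=> j [x [y [[jj xX yY] [h1 h2 h3]]]]; apply: nC.
case/mapP: jj => c cc Ej; rewrite {}Ej /= in h1 h3.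
have xU : x \notin U by rewrite (disjointFl dUX).
have yU : y \notin U by rewrite (disjointFl dUY).
have xy : x != y by apply: contraTneq yY => <-; rewrite (disjointFr dXY).
exists [:: y, x & c]; split.
- by rewrite /= (ck c cc).
- rewrite /= (uniq_flatten_mem ucs cc) !inE negb_or eq_sym xy andbT /=.
  by apply/andP; split; [apply: contra yU|apply: contra xU]; exact: inU.
- have sc := allP pcs c cc.
  case: c cc h1 h3 sc (ck _ cc) => // a c cc h1 h3 sc _ /=.
  have eB u v : eadj B u v -> eadj (A :|: B) u v by rewrite /eadj inE orbC => ->.
  have eA u v : eadj A u v -> eadj (A :|: B) u v by rewrite /eadj inE => ->.
  rewrite /cyclic /= (eB x a h1) (eadj_sym _ y x) (eB x y h2) /= rcons_path.
  by rewrite (sub_path eA sc) (eadj_sym _ _ y) (eB _ _ h3).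
- move=> z; rewrite !inE => /or3P[/eqP ->|/eqP ->|zc].
  + by rewrite yY !orbT.
  + by rewrite xX orbT.
  + by rewrite (inU c z cc zc).
Qed.

(** A union bound over the sets and the lengths. Lengths 1 and 2 are left out of it, since [joined]
    alone provides a vertex or an edge. *)
Lemma cycle_poor_prob s L m t w : (0 < s)%N -> (1 < L)%N ->
  (m * L + L * (2 * s) + 2 * t <= w)%N ->
  p ^+ 2 * (m + t + t)%:R <= 2^-1 ->
  rs_pr p (pairs V) (fun A => joined (eadj A) s /\ ~ cycle_rich w L A)
    <= 2 ^+ #|V| * L.+1%:R * (1 - p ^+ 3 / 2) ^+ (m * (t * t)).
Proof.
move=> s0 L1 wge pM.
pose I (z : {set V} * 'I_L.+1) := (w <= #|z.1|)%N && (2 < z.2)%N.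
pose bad (z : {set V} * 'I_L.+1) (A : {set {set V}}) :=
  joined (eadj A) s /\ ~ has_cycle A z.1 z.2.
have [p0 p1] : 0 <= p /\ p <= 1 by apply/andP.
have C0 : 0 <= 1 - p ^+ 3 / 2.
  by have := exprn_ile1 3 p0 p1; have := exprn_ge0 3 p0 => h1 h2; lra.
apply: le_trans (@rs_pr_bigU _ _ p01 _ _ _ I _ bad _) _.
  move=> A _ [jA /existsNP[l /existsNP[U /not_implyP[/andP[l0 lL] /not_implyP[wU nC]]]]].
  have lL' : (l < L.+1)%N by [].
  exists (U, Ordinal lL') => //; rewrite /I /= wU ltnNge; apply/negP => l2; apply: nC.
  have ws : (l * (2 * s) <= w)%N.
    have : (l * (2 * s) <= L * (2 * s))%N by rewrite leq_mul2r lL orbT.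
    by clear -wge; lia.
  have [c [c1 c2 c3 c4]] : exists c, [/\ size c = l.-1.+1, uniq c, sorted (eadj A) c &
      {subset c <= U}].
    by apply: joined_path s0 jA _; rewrite prednK // (leq_trans ws).
  exists c; rewrite c1 prednK //; split=> //; rewrite /cyclic.
  move: c1 c2 c3; rewrite prednK //; case: c {c4} => [|a [|b [|d c]]] //= sz.
    by move=> _ /andP[ab _]; rewrite ab eadj_sym ab.
  by move: l2; rewrite -sz.
apply: (@le_trans _ _ (\sum_(z | I z) (1 - p ^+ 3 / 2) ^+ (m * (t * t)))); last first.
  rewrite sumr_const -[leLHS]mulr_natl ler_wpM2r ?exprn_ge0 //.
  apply: (@le_trans _ _ (#|{: {set V} * 'I_L.+1}|%:R)); first by rewrite ler_nat max_card.
  rewrite card_prod card_ord -[#|{set V}|]cardsT -powersetT card_powerset cardsT.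
  by rewrite natrM natrX.
apply: ler_sum => -[U [l lL]] /andP[/= wU l2].
case: l lL l2 => [|[|[|k]]] // lL _; rewrite /bad /=.
have kL : (k.+1 <= L)%N by move: lL; clear; lia.
have kL' : (m * k.+1 + k.+1 * (2 * s) <= m * L + L * (2 * s))%N.
  by rewrite leq_add // ?leq_mul2l ?leq_mul2r kL orbT.
have [X XU Xt] : exists2 X : {set V}, X \subset U & #|X| = t.
  by apply: subset_of_card; clear -wU wge; lia.
have [Y YU Yt] : exists2 Y : {set V}, Y \subset U :\: X & #|Y| = t.
  by apply: subset_of_card; rewrite cardsD (setIidPr XU) Xt; clear -wU wge; lia.
have [W WU Wt] : exists2 W : {set V}, W \subset (U :\: X) :\: Y &
    #|W| = (m * k.+1 + k.+1 * (2 * s))%N.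
  apply: subset_of_card; rewrite cardsD (setIidPr YU) Yt cardsD (setIidPr XU) Xt.
  by clear -wU wge kL'; lia.
have dWX : [disjoint W & X].
  apply: disjointWl WU _; rewrite -setI_eq0; apply/eqP/setP => z; rewrite !inE.
  by case: (z \in X); rewrite ?andbF.
have dWY : [disjoint W & Y].
  apply: disjointWl WU _; rewrite -setI_eq0; apply/eqP/setP => z; rewrite !inE.
  by case: (z \in Y); rewrite ?andbF.
have dXY : [disjoint X & Y].
  apply: disjointWr YU _; exact: disjoint_setDr.
have pM' : p ^+ 2 * (m + #|X| + #|Y|)%:R <= 2^-1 by rewrite Xt Yt.
have Wm : (m * k.+1 + k.+1 * (2 * s) <= #|W|)%N by rewrite Wt.
have := no_cycle_prob dWX dWY dXY s0 Wm pM'; rewrite Xt Yt; apply: le_trans.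
apply: ler_rs_pr => // A _ [jA nC]; split=> // -[c [c1 c2 c3 c4]]; apply: nC.
exists c; split=> // x /c4; rewrite !inE => /orP[/orP[/(subsetP WU)|/(subsetP XU)//]|/(subsetP YU)].
  by rewrite !inE => /and3P[].
by rewrite !inE => /andP[].
Qed.

End ShortCycles.

(** * Failure probability *)

Section BadShapes.
Variables (R : realFieldType) (V : finType) (G : sgraph V) (L t M g : nat) (p gam : R).
Hypothesis p01 : 0 <= p <= 1.

Definition relabel (pi : {perm V}) (A : {set {set V}}) : {set {set V}} :=
  (fun e : {set V} => pi @: e) @: A.

Lemma relabelE pi A u v : eadj (relabel pi A) (pi u) (pi v) = eadj A u v.
Proof.
rewrite /eadj /relabel -(mem_imset A [set u; v] (imset_inj (@perm_inj _ pi))).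
by rewrite imsetU !imset_set1.
Qed.

Lemma relabelK (pi : {perm V}) A : relabel pi^-1%g (relabel pi A) = A.
Proof.
rewrite /relabel -imset_comp -[RHS]imset_id; apply: eq_imset => e /=.
by rewrite -imset_comp -[RHS]imset_id; apply: eq_imset => x /=; rewrite permK.
Qed.

Lemma packs_relabel pi A sh (ds : seq (seq V)) : packs sh A ds ->
  packs sh (relabel pi A) (map (map pi) ds).
Proof.
move=> [d1 d2 d3]; split.
- by rewrite -map_comp -d1; apply: eq_map => d /=; rewrite size_map.
- by rewrite -map_flatten map_inj_uniq //; exact: perm_inj.
- rewrite all_map; apply: sub_all d3 => d /=; rewrite cyclic_map.
  rewrite /cyclic => /orP[->//|cd]; apply/orP; right.
  by rewrite (eq_cycle (e' := eadj A)) // => u v; exact: relabelE.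
Qed.

Lemma all_triples_map (f : V -> V) (ds : seq (seq V)) :
  all_triples (map (map f) ds) = [seq (f t.1.1, f t.1.2, f t.2) | t <- all_triples ds].
Proof.
rewrite /all_triples map_flatten -!map_comp; congr flatten.
by apply: eq_map => c /=; rewrite triples_map.
Qed.

Lemma packs_relabelV (pi : {perm V}) A sh (ds : seq (seq V)) :
  packs sh (relabel pi A) ds ->
  exists2 ds', packs sh A ds' & size (all_triples ds') = size (all_triples ds).
Proof.
move=> /(packs_relabel pi^-1%g); rewrite relabelK => h.
by eexists; [exact: h|rewrite all_triples_map size_map].
Qed.

(** The law of the edge set is invariant under relabelling, so the probability may be averaged over
    all permutations. With the sums exchanged, the edge set and one packing of it are fixed, and it
    remains to count the permutations for which the relabelled packing fails at some pair
    [(u, v)]. *)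
Lemma bad_shape_prob k :
  (forall v, g + 3 * M <= degree G v)%N ->
  gam * (#|V| ^ 3)%:R <= (g ^ 3)%:R -> 0 <= gam <= 1 ->
  rs_pr p (pairs V) (@bad_shape V G L t M k) <=
    (#|V| ^ 2)%:R * (2 ^+ t * (1 - gam / 2) ^+ M).
Proof.
move=> degG gam_le gam01.
pose S : R := #|{perm V}|%:R.
have S0 : 0 < S by rewrite ltr0n; apply/card_gt0P; exists 1%g.
rewrite -(ler_pM2l S0).
have Erel pi : rs_pr p (pairs V) (@bad_shape V G L t M k) =
    rs_exp p (pairs V) (fun A => (`[< @bad_shape V G L t M k (relabel pi A) >])%:R).
  have hI : injective (fun e : {set V} => pi @: e) by exact: imset_inj (@perm_inj _ pi).
  suff hD : (fun e : {set V} => pi @: e) @: pairs V = pairs V.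
    by rewrite /rs_pr -(rs_exp_reindex p _ hI hD).
  apply/setP => e; rewrite inE; apply/imsetP/idP => [[e' + ->]|e2].
    by rewrite inE card_imset //; exact: perm_inj.
  exists ((pi^-1 : {perm V})%g @: e).
    by rewrite inE card_imset //; exact: perm_inj.
  rewrite -imset_comp -[LHS]imset_id; apply: eq_imset => x /=.
  by rewrite permKV.
rewrite [leLHS](_ : _ = \sum_(pi : {perm V}) rs_exp p (pairs V)
    (fun A => (`[< @bad_shape V G L t M k (relabel pi A) >])%:R)); last first.
  under eq_bigr => pi _ do rewrite -Erel.
  by rewrite sumr_const /S mulr_natl.
rewrite -rs_exp_sum -[leRHS](rs_exp_cst p (pairs V)).
apply: ler_rs_exp => // A _.
have q0 : 0 <= 1 - gam / 2 by case/andP: gam01 => *; lra.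
have [[ds0 [pk0 M0]]|nods] := pselect (exists ds, packs (@shape_of V L k) A ds /\
    (M <= size (all_triples ds))%N); last first.
  rewrite big1 ?mulr_ge0 ?exprn_ge0 ?ler0n //.
  move=> pi _; case: asboolP => // -[[ds [pk Md]] _]; case: nods.
  by have [ds' pk' E] := packs_relabelV pk; exists ds'; rewrite E.
(* Exactly [M] triples are kept, because each triple costs three vertices of the neighbourhoods in
   [few_hits]. *)
pose T := take M (all_triples ds0).
have sT : size T = M by rewrite size_takel.
have uT : uniq (flatten (map (@tseq V) T)).
  have [_ /uniq_triples u0 _] := pk0; apply: subseq_uniq u0.
  rewrite -[X in subseq _ (flatten (map _ X))](cat_take_drop M) map_cat flatten_cat; exact: prefix_subseq.
pose N v := [set x | adj G v x].
pose B (z : V * V) := [set pi | (count (hits (N z.2) (N z.1) pi) T < t)%N].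
apply: (@le_trans _ _ (\sum_(z : V * V) #|B z|%:R)).
  apply: (@le_trans _ _ (\sum_(pi : {perm V}) \sum_(z : V * V) (pi \in B z)%:R)).
    apply: ler_sum => pi _; case: asboolP => [[_ nabs]|_]; last first.
      by apply: sumr_ge0 => z _; rewrite ler0n.
    have : ~ absorbing G t (map (map pi) ds0).
      by move=> h; apply: nabs; exists (map (map pi) ds0); split=> //; exact: packs_relabel.
    move=> /existsNP[u /existsNP[v /negP]]; rewrite -ltnNge => lt.
    rewrite (bigD1 (u, v)) //= (_ : pi \in B (u, v)) ?lerDl ?sumr_ge0 //.
    rewrite inE; apply: leq_ltn_trans lt; rewrite all_triples_map count_map.
    rewrite -[X in (_ <= count _ X)%N](cat_take_drop M) count_cat.
    apply: leq_trans (leq_addr _ _); rewrite leq_eqVlt; apply/orP; left; apply/eqP.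
    by apply: eq_count => x; rewrite /hits /absorbs /= !inE.
  rewrite exchange_big /=; apply: ler_sum => z _.
  by rewrite -sum1_card natr_sum [leLHS]big_mkcond [leRHS]big_mkcond /=;
     apply: ler_sum => pi _; case: (pi \in B z).
apply: (@le_trans _ _ (\sum_(z : V * V) (2 ^+ t * (1 - gam / 2) ^+ M * S))).
  apply: ler_sum => z _; rewrite -sT.
  have dN v : (g + 3 * size T <= #|N v|)%N by rewrite sT; exact: degG.
  exact: few_hits (dN _) (dN _) gam_le gam01.
rewrite sumr_const card_prod -[leLHS]mulr_natl mulnn; set c := 2 ^+ t * _.
by rewrite [leRHS]mulrC mulrA.
Qed.

Lemma not_completes_prob s w r0 m tt : (3 < L)%N -> (0 < s)%N ->
  (forall r, r0 <= r \/ #|V| - 2 <= L.+2 * r -> L.-1 * r <= 2 * #|V| + L.-1 * r0 ->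
     [/\ w <= 2 * r, 5 * M + 4 * r + 2 <= #|V| & 2 * r + 2 * s <= t])%N ->
  (m * L + L * (2 * s) + 2 * tt <= w)%N -> p ^+ 2 * (m + tt + tt)%:R <= 2^-1 ->
  (forall v, g + 3 * M <= degree G v)%N ->
  gam * (#|V| ^ 3)%:R <= (g ^ 3)%:R -> 0 <= gam <= 1 ->
  rs_pr p (pairs V) (fun A => ~ completes G A) <=
    4 ^+ #|V| * (1 - p) ^+ (s ^ 2)
    + 2 ^+ #|V| * L.+1%:R * (1 - p ^+ 3 / 2) ^+ (m * (tt * tt))
    + (#|V|.+1 ^ L.+1)%:R * ((#|V| ^ 2)%:R * (2 ^+ t * (1 - gam / 2) ^+ M)).
Proof.
move=> L3 s0 Hr Hw pM degG gam_le gam01.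
have L1 : (1 < L)%N by apply: leq_trans L3.
pose P1 (A : {set {set V}}) := ~ joined (eadj A) s.
pose P2 (A : {set {set V}}) := joined (eadj A) s /\ ~ cycle_rich w L A.
pose P3 (A : {set {set V}}) := exists k, @bad_shape V G L t M k A.
apply: (@le_trans _ _ (rs_pr p (pairs V) (fun A => (P1 A \/ P2 A) \/ P3 A))).
  apply: ler_rs_pr => // A _ nC.
  have [jA|] := pselect (joined (eadj A) s); last by left; left.
  have [rA|nr] := pselect (cycle_rich w L A); last by left; right.
  right; apply: contrapT => nb; apply: nC.
  by apply: (completion L3 Hr jA rA) => k bk; apply: nb; exists k.
apply: le_trans (rs_prU p01 _ _ _) _; apply: lerD.
  apply: le_trans (rs_prU p01 _ _ _) _; apply: lerD.
    exact: not_joined_prob.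
  exact: cycle_poor_prob.
apply: le_trans (@rs_pr_bigU _ _ p01 _ _ _ predT _ (fun k => @bad_shape V G L t M k) _) _.
  by move=> A _ [k bk]; exists k.
apply: (@le_trans _ _ (\sum_(k : {ffun 'I_L.+1 -> 'I_#|V|.+1})
    (#|V| ^ 2)%:R * (2 ^+ t * (1 - gam / 2) ^+ M))).
  by apply: ler_sum => k _; exact: bad_shape_prob.
by rewrite sumr_const card_ffun !card_ord -[leLHS]mulr_natl.
Qed.

End BadShapes.

(** * Random edge sets and the binomial random graph *)

Section Gnp.
Variables (R : realFieldType) (n : nat).
Implicit Types (G : sgraph 'I_n) (p : R).

Lemma gnp_probE p (P : {set {set 'I_n}} -> Prop) :
  gnp_prob p (fun H => `[< P (edges H) >]) = rs_pr p (pairs 'I_n) P.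
Proof.
rewrite /gnp_prob /rs_pr /rs_exp.
have s0 : [forall e in (set0 : {set {set 'I_n}}), #|e| == 2%N].
  by apply/forall_inP => e; rewrite inE.
(* [insubd] inverts [edges] on sets of pairs; the empty graph is only a default value. *)
rewrite (reindex_onto (@edges _) (fun A => insubd (SGraph s0) A)) /=; last first.
  move=> A AD; have AP : [forall e in A, #|e| == 2%N].
    by apply/forall_inP => e /(subsetP AD); rewrite inE.
  by rewrite -[edges _]/(val _) insubdK.
rewrite big_mkcond [RHS]big_mkcond /=; apply: eq_bigr => H _.
have -> : insubd (SGraph s0) (edges H) == H by rewrite -[edges H]/(val H) valKd eqxx.
have -> : edges H \subset pairs 'I_n.
  by apply/subsetP => e eH; rewrite inE; apply: (forall_inP (edgesP H)).
rewrite /= /gnp_mass /rs_mass; case: asboolP => _; rewrite ?mulr0 // mulr1.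
by apply: eq_bigl => e; rewrite inE.
Qed.

Lemma universalE G H :
  universal (bounded_degree_graphs n 2) (gunion G H) = `[< completes G (edges H) >].
Proof.
apply/forall_inP/asboolP => [U F dF|C F].
  have /existsP[f /andP[/injectiveP fI /forallP fE]] : contains_copy (gunion G H) F.
    by apply: U; rewrite inE.
  exists f => // u v uv; have /forallP/(_ v)/implyP/(_ uv) := fE u.
  by rewrite /adj inE.
rewrite inE => /C[f fI fE]; apply/existsP; exists [ffun x => f x].
apply/andP; split; first by apply/injectiveP => x y; rewrite !ffunE => /fI.
apply/forallP => u; apply/forallP => v; apply/implyP => /fE.
by rewrite /adj inE !ffunE.
Qed.

Lemma completes_increasing G :
  increasing (fun A => (`[< completes G A >])%:R : R).
Proof.
move=> A B AB; apply: ler_bool => /asboolP C; apply/asboolP => F /C[f fI fE].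
exists f => // u v /fE /orP[->//|h]; apply/orP; right; exact: (subsetP AB).
Qed.

Lemma rs_prC p (T : finType) (D : {set T}) (P : {set T} -> Prop) :
  rs_pr p D P = 1 - rs_pr p D (fun A => ~ P A).
Proof.
apply/eqP; rewrite eq_sym subr_eq -rs_expD -{1}(rs_exp_cst p D 1); apply/eqP.
apply: eq_rs_exp => A _; rewrite asbool_neg; case: (`[< P A >]) => /=.
  by rewrite addr0.
by rewrite add0r.
Qed.

Lemma min_degree_le G v : (min_degree G <= degree G v)%N.
Proof.
rewrite /min_degree; have : v \in index_enum 'I_n by rewrite mem_index_enum.
elim: (index_enum _) => // x l IH; rewrite big_cons inE geq_min => /orP[/eqP ->|/IH ->].
  by rewrite leqnn.
by rewrite orbT.
Qed.

End Gnp.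

(** * Asymptotics *)

From mathcomp Require Import all_classical all_reals all_analysis.
Import numFieldNormedType.Exports.

Local Open Scope classical_set_scope.
Local Open Scope ring_scope.

Lemma expr1B_le (R : realType) (x : R) k : x <= 1 -> (1 - x) ^+ k <= expR (- (k%:R * x)).
Proof.
move=> x1; rewrite -mulrN expRM_natl; apply: lerXn2r; rewrite ?nnegrE ?subr_ge0 ?expR_ge0 //.
exact: expR_ge1Dx.
Qed.

Lemma expr2_le (R : realType) n : 2 ^+ n <= expR n%:R :> R.
Proof.
rewrite -[n%:R]mulr1 expRM_natl; apply: lerXn2r; rewrite ?nnegrE ?expR_ge0 //.
by have := expR_ge1Dx (1 : R).
Qed.

(** With [N = n.+1], the term of degree [k.+1] in the exponential series of [N / T] dominates
    [N ^+ k.+1] up to a constant, one power more than has to be absorbed. *)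
Lemma poly_expRN_le (R : realType) (k T : nat) : (0 < T)%N ->
  exists C : R, forall n : nat, (n.+1)%:R ^+ k * expR (1 - n%:R / T%:R) <= C / n.+1%:R.
Proof.
move=> T0; have T0' : 0 < T%:R :> R by rewrite ltr0n.
exists ((k.+1)`!%:R * T%:R ^+ k.+1 * expR (1 + T%:R^-1)) => n.
set N : R := n.+1%:R; have N0 : 0 < N by rewrite ltr0n.
have -> : expR (1 - n%:R / T%:R) = expR (1 + T%:R^-1) * expR (- (N / T%:R)) :> R.
  rewrite -expRD; congr expR; rewrite /N -natr1 mulrDl mul1r; lra.
have F0 : 0 < (k.+1)`!%:R :> R by rewrite ltr0n fact_gt0.
have H : (N / T%:R) ^+ k.+1 / (k.+1)`!%:R <= expR (N / T%:R).
  have NT : 0 <= N / T%:R by rewrite divr_ge0 // ltW.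
  by apply: le_trans (expR_ge1Dxn k NT); rewrite ler_wpDl.
have H2 : N ^+ k.+1 <= (k.+1)`!%:R * T%:R ^+ k.+1 * expR (N / T%:R).
  move: H; rewrite ler_pdivrMr // expr_div_n ler_pdivrMr ?exprn_gt0 // => /le_trans; apply.
  by rewrite le_eqVlt; apply/orP; left; apply/eqP; ring.
rewrite ler_pdivlMr // expRN.
have E0 := expR_gt0 (N / T%:R).
rewrite [leLHS](_ : _ = expR (1 + T%:R^-1) * (N ^+ k.+1 / expR (N / T%:R))); last first.
  by rewrite exprS; ring.
rewrite [leRHS]mulrC ler_wpM2l ?expR_ge0 //.
by rewrite ler_pdivrMr.
Qed.

Section ErrorBound.
Variables (R : realType) (a n Q T0 L K : nat) (z : R).
Hypotheses (a0 : (0 < a)%N) (EQ : (64 * a ^ 3 = Q)%N) (ET : (32 * a * Q = T0)%N)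
  (EL : (16 * T0).+1 = L) (EK : (16 * L ^ 2 = K)%N) (Kn : (K <= n)%N).
Hypotheses (zn : z ^+ 3 = n%:R) (zK : 32 * K%:R ^+ 2 <= z).

(** As [z] is the cube root of [n], this is $4 K n^{-2/3}$. Since [s] is at least [n / (2 * K)], the
    factor 4 makes [s ^ 3 * q ^ 3] at least [8 * n], enough for Janson's bound to beat [2 ^+ n]. *)
Let q : R := 4 * K%:R / z ^+ 2.
Let s := (n %/ K)%N.
Let t := (n %/ T0)%N.

Let K1 : 1 <= K%:R :> R.
Proof. by rewrite ler1n -EK -EL muln_gt0 expn_gt0. Qed.

Let z1 : 1 <= z.
Proof. by apply: le_trans zK; have := K1; nra. Qed.

Let s_ge : n%:R / (2 * K%:R) <= s%:R :> R.
Proof.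
have Kp : (0 < K)%N by rewrite -EK -EL muln_gt0 expn_gt0.
have s0 : (0 < s)%N by rewrite divn_gt0.
have : (n <= s * (2 * K))%N.
  by have := ltn_ceil n Kp; rewrite -/s mulSn; move: (s * K)%N (mulnCA s 2 K) (leq_mul s0 (leqnn K)); rewrite mul1n; lia.
rewrite -(ler_nat R) natrM natrM => h; rewrite ler_pdivrMr //.
by have := K1; lra.
Qed.

Lemma error_bound : q ^+ 2 * (s + s + s)%:R <= 2^-1 /\ (q <= 1 ->
  4 ^+ n * (1 - q) ^+ (s ^ 2) + 2 ^+ n * L.+1%:R * (1 - q ^+ 3 / 2) ^+ (s * (s * s))
    + (n.+1 ^ L.+1)%:R * ((n ^ 2)%:R * (2 ^+ t * (1 - (Q%:R^-1) / 2) ^+ (4 * Q * t)))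
  <= L.+2%:R * expR (- n%:R) + n.+1%:R ^+ L.+3 * expR (1 - n%:R / T0%:R)).
Proof.
have K1' := K1; have z1' := z1; have s1 := s_ge; have zK' := zK; have zn' := zn.
have z0 : 0 < z by lra.
have K0 : 0 < K%:R :> R by lra.
have q0 : 0 < q by rewrite divr_gt0 ?mulr_gt0 ?exprn_gt0.
have qz : q * z ^+ 2 = 4 * K%:R by rewrite /q divfK // gt_eqF // exprn_gt0.
have n0 : 0 <= n%:R :> R by [].
have sle : (s + s + s <= n)%N.
  have : (s * K <= n)%N by exact: leq_trunc_div.
  have : (3 <= K)%N by rewrite -EK -EL; clear; nia.
  by clear; nia.
split.
  apply: (@le_trans _ _ (q ^+ 2 * n%:R)).
    by apply: ler_wpM2l; rewrite ?ler_nat // exprn_ge0 // ltW.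
  (* So [q ^+ 2 * n%:R] is [16 * K%:R ^+ 2 / z]; asking for at most one half explains
     [32 * K%:R ^+ 2 <= z]. *)
  have E : q ^+ 2 * n%:R * z = 16 * K%:R ^+ 2.
    have : (q * z ^+ 2) ^+ 2 = q ^+ 2 * z ^+ 3 * z by ring.
    by rewrite qz -zn => <-; ring.
  have : q ^+ 2 * n%:R * z <= 2^-1 * z by rewrite E; lra.
  by rewrite ler_pM2r.
move=> q1.
have sn2 : (n%:R / (2 * K%:R)) ^+ 2 <= s%:R ^+ 2 :> R.
  by apply: lerXn2r; rewrite ?nnegrE ?divr_ge0 // ?mulr_ge0 // ltW.
have sn3 : (n%:R / (2 * K%:R)) ^+ 3 <= s%:R ^+ 3 :> R.
  by apply: lerXn2r; rewrite ?nnegrE ?divr_ge0 // ?mulr_ge0 // ltW.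
(* This outweighs the factor [4 ^+ n], which is at most [expR (2 * n%:R)]. *)
have b1 : 3 * n%:R <= (s ^ 2)%:R * q.
  rewrite natrX; apply: le_trans (ler_wpM2r (ltW q0) sn2).
  have -> : (n%:R / (2 * K%:R)) ^+ 2 * q = z ^+ 4 / K%:R.
    rewrite -zn /q; field; rewrite ?gt_eqF //.
  rewrite ler_pdivlMr // -zn.
  have -> : z ^+ 4 = z ^+ 3 * z by ring.
  rewrite -mulrA [3 * _]mulrC -mulrA ler_pM2l ?exprn_gt0 //.
  by nra.
have b2 : 4 * n%:R <= (s * (s * s))%:R * q ^+ 3.
  have -> : (s * (s * s))%:R = s%:R ^+ 3 :> R by rewrite !natrM; ring.
  apply: le_trans (ler_wpM2r (exprn_ge0 _ (ltW q0)) sn3).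
  have -> : (n%:R / (2 * K%:R)) ^+ 3 * q ^+ 3 = 8 * z ^+ 3.
    rewrite -zn /q; field; rewrite ?gt_eqF //.
  by rewrite zn; lra.
have q31 : q ^+ 3 / 2 <= 1 by have := exprn_ile1 3 (ltW q0) q1; lra.
have Qp : (0 < Q)%N by rewrite -EQ muln_gt0 expn_gt0 a0.
have Q1 : 1 <= Q%:R :> R by rewrite ler1n.
have T0p : (0 < T0)%N by rewrite -ET !muln_gt0 a0 Qp.
have t1 : n%:R / T0%:R - 1 <= t%:R :> R.
  rewrite lerBlDr ler_pdivrMr ?ltr0n // natr1 -natrM ler_nat.
  exact: ltnW (ltn_ceil n T0p).
have -> : L.+2%:R = 1 + L.+1%:R :> R by rewrite -[in LHS]addn1 natrD addrC.
rewrite mulrDl mul1r; apply: lerD; first apply: lerD.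
- apply: (@le_trans _ _ (expR (2 * n%:R) * expR (- ((s ^ 2)%:R * q)))).
    apply: ler_pM; rewrite ?exprn_ge0 ?subr_ge0 //; last exact: expr1B_le.
    have -> : 2 * n%:R = n%:R + n%:R :> R by lra.
    rewrite expRD (_ : 4 ^+ n = 2 ^+ n * 2 ^+ n) ?ler_pM ?exprn_ge0 ?expr2_le //.
    by rewrite -exprMn; congr (_ ^+ _); lra.
  by rewrite -expRD ler_expR; lra.
- rewrite mulrAC [leRHS]mulrC; apply: ler_wpM2r => //.
  apply: (@le_trans _ _ (expR n%:R * expR (- ((s * (s * s))%:R * (q ^+ 3 / 2))))).
    apply: ler_pM; rewrite ?exprn_ge0 ?subr_ge0 ?expr2_le //; exact: expr1B_le.
  by rewrite -expRD ler_expR; lra.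
- rewrite mulrA; apply: ler_pM.
  + by rewrite mulr_ge0.
  + rewrite mulr_ge0 ?exprn_ge0 //.
    have : Q%:R^-1 <= 1 :> R by rewrite invf_le1 // ltr0n.
    by lra.
  + rewrite -natrM -natrX ler_nat (_ : L.+3 = L.+1 + 2)%N; last by rewrite addn2.
    by rewrite expnD leq_mul2l leq_exp2r // leqnSn orbT.
  + have Qi : Q%:R^-1 <= 1 :> R by rewrite invf_le1 // ltr0n.
    apply: (@le_trans _ _ (expR t%:R * expR (- ((4 * Q * t)%:R * (Q%:R^-1 / 2))))).
      apply: ler_pM; rewrite ?exprn_ge0 ?expr2_le //; first by lra.
      by apply: expr1B_le; lra.
    rewrite -expRD ler_expR !natrM.
    (* The number [4 * Q * t] of triples is chosen so that this exponent outweighs the factor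
       [2 ^+ t]. *)
    have -> : 4 * Q%:R * t%:R * (Q%:R^-1 / 2) = 2 * t%:R :> R.
      by field; rewrite gt_eqF // ltr0n.
    by lra.
Qed.

End ErrorBound.

Theorem theorem1p1 (R : realType) (alpha : R) (p : nat -> R)
    (G : forall n : nat, sgraph 'I_n)
    (alpha_gt0 : 0 < alpha)
    (p01 : forall n : nat, 0 <= p n <= 1)
    (p_omega : p n * n%:R `^ (2 / 3) @[n --> \oo] --> +oo)
    (mindegG : \forall n \near \oo,
       alpha * n%:R <= (min_degree (G n))%:R) :
  gnp_prob (p n) (fun H => universal (bounded_degree_graphs n 2) (gunion (G n) H))
    @[n --> \oo] --> (1 : R).
Proof.
have [a a0 aP] : exists2 a : nat, (0 < a)%N & 1 <= alpha * a%:R.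
  have h : alpha^-1 < (Num.bound alpha^-1)%:R.
    by apply: archi_boundP; rewrite invr_ge0 ltW.
  exists (Num.bound alpha^-1).+1 => //.
  by rewrite -ler_pdivrMl // mulr1; apply: le_trans (ltW h) _; rewrite ler_nat.
(* With [g] about [n / (4 * a)], a resampled triple is hit with probability at least [(g / n) ^ 3],
   about [1 / Q]. [T0] makes three times [M = 4 * Q * (n %/ T0)] at most [3 * n / (8 * a)], which
   together with [g] fits below the degree bound [n / a]. [L] makes the removed pairs few compared
   with [n %/ T0], and [K] makes the reserved sets small compared with [n %/ L]. *)
pose Q := (64 * a ^ 3)%N; pose T0 := (32 * a * Q)%N; pose L := (16 * T0).+1.
pose K := (16 * L ^ 2)%N.
have Qp : (0 < Q)%N by rewrite muln_gt0 expn_gt0 a0.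
have T0p : (0 < T0)%N by rewrite !muln_gt0 a0.
have [C3 C3P] := poly_expRN_le R L.+3 T0p.
pose C := L.+2%:R + C3.
have lower : 1 - C * harmonic n @[n --> \oo] --> (1 : R).
  rewrite -[X in _ --> X]subr0 -(mulr0 C).
  apply: cvgB; first exact: cvg_cst.
  by apply: cvgMr; exact: cvg_harmonic.
apply: squeeze_cvgr; [|exact: lower|exact: cvg_cst].
have pC : \forall n \near \oo, (4 * K%:R : R) <= p n * n%:R `^ (2 / 3).
  by move/cvgryPge : p_omega; apply.
near=> n.
have dn : alpha * n%:R <= (min_degree (G n))%:R by near: n.
have pn : 4 * K%:R <= p n * n%:R `^ (2 / 3) by near: n.
have nbig : ((32 * K ^ 2) ^ 3 <= n)%N by near: n; exact: nbhs_infty_ge.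
have Kp : (0 < K)%N by rewrite muln_gt0 expn_gt0.
have K32 : (K <= 32 * K ^ 2)%N by rewrite expnS expn1 mulnA leq_pmull // muln_gt0 Kp.
have Kn : (K <= n)%N.
  apply: (leq_trans _ nbig); apply: (leq_trans K32).
  by rewrite -[leqLHS]expn1 leq_pexp2l // (leq_trans Kp K32).
have n0 : (0 < n)%N by apply: leq_trans Kn.
pose z : R := n%:R `^ (3^-1).
have zn : z ^+ 3 = n%:R.
  by rewrite /z -powR_mulrn ?powR_ge0 // -powRrM mulVf // powRr1.
have zz : z ^+ 2 = n%:R `^ (2 / 3).
  by rewrite /z -powR_mulrn ?powR_ge0 // -powRrM mulrC.
have z0 : 0 < z by rewrite powR_gt0 // ltr0n.
have zK : 32 * K%:R ^+ 2 <= z.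
  rewrite -(@ler_pXn2r _ 3) ?nnegrE ?mulr_ge0 ?exprn_ge0 ?(ltW z0) // zn.
  by rewrite -(ler_nat R) in nbig; rewrite natrX natrM natrX in nbig.
pose q : R := 4 * K%:R / z ^+ 2.
have q0 : 0 <= q by rewrite divr_ge0 ?mulr_ge0 ?exprn_ge0 ?ltW.
have qp : q <= p n by rewrite ler_pdivrMr ?exprn_gt0 // zz.
have [p0 p1] : 0 <= p n /\ p n <= 1 by apply/andP.
have q1 : q <= 1 by exact: le_trans p1.
have q01 : 0 <= q <= 1 by rewrite q0.
have -> : gnp_prob (p n) (fun H => universal (bounded_degree_graphs n 2) (gunion (G n) H)) =
    rs_pr (p n) (pairs 'I_n) (completes (G n)).
  by rewrite -gnp_probE /gnp_prob; apply: eq_bigl => H; exact: universalE.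
apply/andP; split; last first.
  by rewrite rs_prC gerBl rs_pr_ge0.
(* Universality is monotone in the edge set, so it suffices to treat [q <= p n]. *)
apply: (@le_trans _ _ (rs_pr q (pairs 'I_n) (completes (G n)))); last first.
  by apply: ler_rs_exp_p => //; exact: completes_increasing.
rewrite rs_prC lerD2l lerN2.
have [Hr Hw s0 Hd] := parameters a0 (erefl Q) (erefl T0) (erefl L) (erefl K) Kn.
have [qs err] := error_bound a0 (erefl Q) (erefl T0) (erefl L) (erefl K) Kn zn zK.
have Q0 : 0 < Q%:R :> R by rewrite ltr0n.
have degG v : ((n %/ (4 * a)).+1 + 3 * (4 * Q * (n %/ T0)) <= degree (G n) v)%N.
  apply: Hd; rewrite -(ler_nat R) natrM.
  apply: (@le_trans _ _ (a%:R * (min_degree (G n))%:R)); last first.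
    by rewrite ler_wpM2l // ler_nat min_degree_le.
  apply: (@le_trans _ _ (a%:R * (alpha * n%:R))); last by rewrite ler_wpM2l.
  by rewrite mulrA [a%:R * _]mulrC ler_peMl.
have gam_le : Q%:R^-1 * (#|'I_n| ^ 3)%:R <= ((n %/ (4 * a)).+1 ^ 3)%:R :> R.
  rewrite card_ord ler_pdivrMl // -natrM ler_nat.
  (* The successor rounds [n / (4 * a)] up, so that the bound [1 / Q] holds without an error
     term. *)
  have -> : (Q * (n %/ (4 * a)).+1 ^ 3 = (4 * a * (n %/ (4 * a)).+1) ^ 3)%N.
    by rewrite !expnMn.
  by rewrite leq_exp2r // mulnC ltnW // ltn_ceil // muln_gt0.
have gam01 : (0 <= (Q%:R^-1 : R)) && ((Q%:R^-1 : R) <= 1).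
  by apply/andP; split; [rewrite invr_ge0 ltW|rewrite invf_le1 // ler1n].
have L3 : (3 < L)%N by rewrite /L; clear -T0p; lia.
have := @not_completes_prob R 'I_n (G n) L (n %/ T0) (4 * Q * (n %/ T0))
  (n %/ (4 * a)).+1 q Q%:R^-1 q01 (n %/ K) (n %/ L) (n %/ L) (n %/ K) (n %/ K) L3 s0.
rewrite card_ord => /(_ Hr Hw qs degG); rewrite card_ord in gam_le.
move=> /(_ gam_le gam01) /le_trans; apply.
apply: le_trans (err q1) _.
rewrite /C [leRHS]mulrDl; apply: lerD; last exact: C3P.
rewrite ler_wpM2l // /harmonic expRN lef_pV2 ?posrE ?expR_gt0 ?ltr0n //.
by rewrite -natr1 addrC expR_ge1Dx.
Unshelve. all: by end_near.
Qed.
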